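(* When $G$ is a path, Complete-EF-CFD (does the instance admit a complete envy-free valid allocation?) is in XP with respect to the number $p$ of player types; that is, it can be decided in time $|I|^{f(p)}$ for some computable function $f$.
   Context: An instance of the connected fair division problem (CFD) is a triple $I=(G,N,\mathcal U)$ where $G=(V,E)$ is a finite undirected graph whose vertices are called items, $N=\{1,\dots,n\}$ is a set of players, and $\mathcal U=(u_1,\dots,u_n)$ with $u_i:V\to\mathbb Q_{\ge 0}$ and $\sum_{v\in V}u_i(v)=1$ for every $i$. Utilities are additive: $u_i(X)=\sum_{v\in X}u_i(v)$. An allocation $\pi:N\to 2^V$ is valid if each $\pi(i)$ induces a connected subgraph of $G$ and $\pi(i)\cap\pi(j)=\emptyset$ for $i\neq j$. A valid allocation is envy-free if $u_i(\pi(i))\ge u_i(\pi(j))$ for all $i,j\in N$, and complete if $\bigcup_{i\in N}\pi(i)=V$. Two players are of the same type if they have identical utility functions; $p$ is the number of distinct types. *)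

(* Defs.v *)
From mathcomp Require Import all_boot all_order all_algebra all_fingroup.
Set Implicit Arguments. Unset Strict Implicit. Unset Printing Implicit Defensive.
Import Order.TTheory GRing.Theory Num.Theory.
Local Open Scope ring_scope.

(* Items are 'I_m, players are 'I_n (player i+1 of the paper is i),    *)
(* the graph is given by an adjacency relation adj on 'I_m and the     *)
(* utilities by u : 'I_n -> 'I_m -> rat.                               *)

Definition simple_graph (m : nat) (adj : rel 'I_m) : Prop :=
  (forall x y, adj x y = adj y x) /\ (forall x, adj x x = false).

Definition is_path_graph (m : nat) (adj : rel 'I_m) : Prop :=
  simple_graph adj /\
  exists s : {perm 'I_m}, forall x y : 'I_m,
    adj x y = ((s x).+1 == s y)%N || ((s y).+1 == s x)%N.

Definition valid_utilities (m n : nat) (u : 'I_n -> 'I_m -> rat) : Prop :=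
  (forall i v, 0 <= u i v) /\ (forall i, \sum_(v : 'I_m) u i v = 1).

Definition util (m n : nat) (u : 'I_n -> 'I_m -> rat) (i : 'I_n)
  (X : {set 'I_m}) : rat := \sum_(v in X) u i v.

Definition induces_connected (m : nat) (adj : rel 'I_m) (X : {set 'I_m}) : Prop :=
  forall x y, x \in X -> y \in X ->
    connect [rel a b | [&& adj a b, a \in X & b \in X]] x y.

Definition valid_allocation (m n : nat) (adj : rel 'I_m)
  (pi : 'I_n -> {set 'I_m}) : Prop :=
  (forall i, induces_connected adj (pi i)) /\
  (forall i j, i != j -> [disjoint pi i & pi j]).

Definition envy_free (m n : nat) (u : 'I_n -> 'I_m -> rat)
  (pi : 'I_n -> {set 'I_m}) : Prop :=
  forall i j, util u i (pi j) <= util u i (pi i).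

Definition complete_allocation (m n : nat) (pi : 'I_n -> {set 'I_m}) : Prop :=
  \bigcup_(i : 'I_n) pi i = [set: 'I_m].

Definition has_complete_EF (m n : nat) (adj : rel 'I_m)
  (u : 'I_n -> 'I_m -> rat) : Prop :=
  exists pi : 'I_n -> {set 'I_m},
    [/\ valid_allocation adj pi, envy_free u pi & complete_allocation pi].

Definition num_types (m n : nat) (u : 'I_n -> 'I_m -> rat) : nat :=
  size (undup [seq [ffun v => u i v] : {ffun 'I_m -> rat} | i <- enum 'I_n]).

Definition encode (m n : nat) (adj : rel 'I_m) (u : 'I_n -> 'I_m -> rat)
  : seq nat :=
  [:: m; n] ++
  [seq nat_of_bool (adj i j) | i <- enum 'I_m, j <- enum 'I_m] ++
  flatten [seq flatten [seq [:: `|numq (u i v)|%N; `|denq (u i v)|%N]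
                       | v <- enum 'I_m] | i <- enum 'I_n].

Definition bitlen (x : nat) : nat := (trunc_log 2 x).+1.

Definition enc_size (s : seq nat) : nat := (\sum_(x <- s) bitlen x)%N.

(* Machine model: unit-cost RAM with addition and truncated            *)
(* subtraction, indirect addressing, conditional jumps (polynomially   *)
(* equivalent to Turing machines).                                     *)

Inductive instr : Type :=
| IConst of nat & nat          (* IConst r c : R[r] := c               *)
| IAdd of nat & nat & nat      (* IAdd r a b : R[r] := R[a] + R[b]     *)
| ISub of nat & nat & nat      (* ISub r a b : R[r] := R[a] - R[b]     *)
| ILoad of nat & nat           (* ILoad r a : R[r] := R[R[a]]          *)
| IStore of nat & nat          (* IStore a r : R[R[a]] := R[r]         *)
| IJz of nat & nat             (* IJz r l : if R[r] = 0 goto l         *)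
| IHalt.

Definition program := seq instr.

Definition regs := nat -> nat.

Definition upd (R : regs) (k v : nat) : regs :=
  fun x => if x == k then v else R x.

Definition mstate := (nat * regs)%type.

(* one step; None when the machine is halted (IHalt, or pc outside) *)
Definition step (P : program) (st : mstate) : option mstate :=
  let: (pc, R) := st in
  match nth IHalt P pc with
  | IConst r c => Some (pc.+1, upd R r c)
  | IAdd r a b => Some (pc.+1, upd R r (R a + R b)%N)
  | ISub r a b => Some (pc.+1, upd R r (R a - R b)%N)
  | ILoad r a => Some (pc.+1, upd R r (R (R a)))
  | IStore a r => Some (pc.+1, upd R (R a) (R r))
  | IJz r l => Some (if R r == 0%N then l else pc.+1, R)
  | IHalt => None
  end.

Fixpoint run (P : program) (k : nat) (st : mstate) : mstate :=
  match k with
  | 0 => st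
  | k'.+1 => match step P st with
             | None => st
             | Some st' => run P k' st'
             end
  end.

Definition init_state (inp : seq nat) : mstate :=
  (0%N, fun x => if x == 0%N then size inp else nth 0%N inp x.-1).

Definition halts_within (P : program) (inp : seq nat) (t out : nat) : Prop :=
  exists k, [/\ (k <= t)%N,
                step P (run P k (init_state inp)) = None &
                (run P k (init_state inp)).2 0%N = out].

Definition computable (f : nat -> nat) : Prop :=
  exists Pf : program, forall x, exists t, halts_within Pf [:: x] t (f x).

(* Main.v *)
Require Import Defs.
From mathcomp Require Import all_boot all_order all_algebra all_fingroup.
From mathcomp Require Import zify.
Set Implicit Arguments. Unset Strict Implicit. Unset Printing Implicit Defensive.
Import Order.TTheory GRing.Theory Num.Theory.

(** On a path with m items a complete valid allocation to n players cuts the path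
    into consecutive segments.  In an envy-free allocation players of the same type
    value their own segments equally, so one guesses, for each of the d types, a
    segment whose value is the common threshold of that type; a segment may then be
    given to player i iff no player values it above its threshold and player i values
    it at least at its own.  For a fixed guess a dynamic program over the prefixes of
    the path and the numbers of players of each type already served decides whether
    the guess can be realised.  With L the length of the input, a player of type t has
    weight L^t, so that the served players are recorded by the sum of their weights,
    and a guess is a number below L^d whose base L digits encode the segments.

    The algorithm is written in a small structured language that is compiled to the
    random access machine.  Rational utilities are compared after scaling them by the
    product of the denominators of the player.  Every loop runs at most
    Y = |I|^(p+2) times, hence the running time is at most Y to a constant power. *)

(** A guess need not describe anything sensible. Whatever thresholds are decoded, a player [i]
    values a foreign segment at most at its threshold and its own at least at it, so envy-freeness
    follows through the threshold alone. Conversely a single guess suffices: the one that copies the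
    segment of a representative of each type from an envy-free allocation.

    The dynamic program does not remember who has been served; a reachable list may repeat one
    player and omit another of the same type. Values and thresholds depend on the type only, so such
    a list can be renamed to a permutation of the players once its multiset of types is right, and
    this is what the final code guarantees.

    The scaled utilities are products of up to [m] denominators and may exceed [Y] by far. This is
    affordable because additions have unit cost and a multiplication costs only the bit length of
    its second factor.

    Iterations are bounded per execution of a loop. Nesting then multiplies the bounds, and the
    exponent of [Y] depends on the program text only, not on the instance. *)

(** * The structured language and its weakest preconditions *)

Inductive expr : Type :=
| EC of nat
| EV of nat
| EAdd of expr & expr
| ESub of expr & expr
| ELd of nat & expr.

Inductive com : Type :=
| CAsg of nat & expr
| CSto of nat & expr & expr
| CSeq of com & com
| CIf of expr & com & com
| CWhile of expr & com.

Definition store := ((nat -> nat) * (nat -> nat -> nat))%type.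

Definition setr (s : store) r v : store := (upd s.1 r v, s.2).
Definition seta (s : store) j x v : store :=
  (s.1, fun j' => if j' == j then upd (s.2 j) x v else s.2 j').

Fixpoint eval (e : expr) (s : store) : nat :=
  match e with
  | EC c => c
  | EV r => s.1 r
  | EAdd a b => eval a s + eval b s
  | ESub a b => eval a s - eval b s
  | ELd j a => s.2 j (eval a s)
  end.

Definition wloop (W : (store -> Prop) -> store -> Prop) (e : expr)
    (Q : store -> Prop) :=
  fix loop (n : nat) (s : store) : Prop :=
    if n is n'.+1 then eval e s <> 0 /\ W (loop n') s else eval e s = 0 /\ Q s.

(* Weakest precondition for total correctness, where moreover every execution of
   a loop performs at most Y iterations. *)
Fixpoint wp (Y : nat) (c : com) (Q : store -> Prop) (s : store) : Prop :=
  match c with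
  | CAsg r e => Q (setr s r (eval e s))
  | CSto j a e => Q (seta s j (eval a s) (eval e s))
  | CSeq c1 c2 => wp Y c1 (wp Y c2 Q) s
  | CIf e c1 c2 => if eval e s == 0 then wp Y c2 Q s else wp Y c1 Q s
  | CWhile e c1 => exists2 n, n <= Y & wloop (wp Y c1) e Q n s
  end.

(** * Compilation to the random access machine *)

(* Register 0 holds the base address b of the arrays, registers 1 to 15 are
   temporaries, variable r lives in register r + 16 and entry x of array j in
   register b + 16 x + j. *)
Fixpoint cexp (e : expr) (d : nat) : program :=
  match e with
  | EC c => [:: IConst d c]
  | EV r => [:: IConst d 0; IAdd d (r + 16) d]
  | EAdd a b => cexp a d ++ cexp b d.+1 ++ [:: IAdd d d d.+1]
  | ESub a b => cexp a d ++ cexp b d.+1 ++ [:: ISub d d d.+1]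
  | ELd j a => cexp a d ++ [:: IAdd d d d; IAdd d d d; IAdd d d d; IAdd d d d;
                 IAdd d d 0; IConst d.+1 j; IAdd d d d.+1; ILoad d d]
  end.

Fixpoint ecsz (e : expr) : nat :=
  match e with
  | EC c => 1
  | EV r => 2
  | EAdd a b | ESub a b => (ecsz a + ecsz b).+1
  | ELd j a => ecsz a + 8
  end.

(** Temporaries from [d] upwards act as an evaluation stack and must stay below 16. The bound 48
    keeps variables in registers 16 to 63, below every base of at least 64; the bound 16 on arrays
    is the stride of the interleaving. *)
Fixpoint wfe (e : expr) (d : nat) : bool :=
  match e with
  | EC c => d < 16
  | EV r => (d < 16) && (r < 48)
  | EAdd a b | ESub a b => wfe a d && wfe b d.+1
  | ELd j a => [&& wfe a d, d < 15 & j < 16]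
  end.

Definition cprim (c : com) : program :=
  match c with
  | CAsg r e => cexp e 1 ++ [:: IConst 2 0; IAdd (r + 16) 1 2]
  | CSto j a e => cexp a 1 ++ [:: IAdd 1 1 1; IAdd 1 1 1; IAdd 1 1 1; IAdd 1 1 1;
                    IAdd 1 1 0; IConst 2 j; IAdd 1 1 2] ++ cexp e 2 ++
                    [:: IStore 1 2]
  | _ => [::]
  end.

Fixpoint csz (c : com) : nat :=
  match c with
  | CAsg r e => ecsz e + 2
  | CSto j a e => ecsz a + (7 + (ecsz e + 1))
  | CSeq c1 c2 => csz c1 + csz c2
  | CIf e c1 c2 => ecsz e + (1 + (csz c1 + (2 + csz c2)))
  | CWhile e c1 => ecsz e + (1 + (csz c1 + 2))
  end.

(** Jump targets are absolute, hence the load address [o]. The pair [IConst 1 0], [IJz 1 l] is an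
    unconditional jump. *)
Fixpoint ccom (c : com) (o : nat) : program :=
  match c with
  | CSeq c1 c2 => ccom c1 o ++ ccom c2 (o + csz c1)
  | CIf e c1 c2 =>
      cexp e 1 ++ [:: IJz 1 (o + ecsz e + 1 + csz c1 + 2)] ++
      ccom c1 (o + ecsz e + 1) ++
      [:: IConst 1 0; IJz 1 (o + csz c)] ++ ccom c2 (o + ecsz e + 1 + csz c1 + 2)
  | CWhile e c1 =>
      cexp e 1 ++ [:: IJz 1 (o + csz c)] ++ ccom c1 (o + ecsz e + 1) ++
      [:: IConst 1 0; IJz 1 o]
  | _ => cprim c
  end.

Fixpoint wfc (c : com) : bool :=
  match c with
  | CAsg r e => wfe e 1 && (r < 48)
  | CSto j a e => [&& wfe a 1, wfe e 2 & j < 16]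
  | CSeq c1 c2 => wfc c1 && wfc c2
  | CIf e c1 c2 => [&& wfe e 1, wfc c1 & wfc c2]
  | CWhile e c1 => wfe e 1 && wfc c1
  end.

Lemma size_cexp e d : size (cexp e d) = ecsz e.
Proof.
elim: e d => [c|r|a IHa b IHb|a IHa b IHb|j a IHa] d //=;
  rewrite !size_cat ?IHa ?IHb /=; lia.
Qed.

Lemma size_ccom c o : size (ccom c o) = csz c.
Proof.
elim: c o => [r e|j a e|c1 IH1 c2 IH2|e c1 IH1 c2 IH2|e c1 IH1] o;
  by rewrite /= ?size_cat ?IH1 ?IH2 /= ?size_cat /= ?IH1 ?IH2 ?size_cexp.
Qed.

Fixpoint nsteps (P : program) (k : nat) (st : mstate) : option mstate :=
  if k is k'.+1 then obind (nsteps P k') (step P st) else Some st.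

Lemma nsteps_cat P k1 k2 st st1 st2 :
  nsteps P k1 st = Some st1 -> nsteps P k2 st1 = Some st2 ->
  nsteps P (k1 + k2) st = Some st2.
Proof.
elim: k1 st => [st [->] //|k1 IH st] /=.
by case: (step P st) => [st'|] //=; apply: IH.
Qed.

Lemma run_nsteps P k st st' : nsteps P k st = Some st' -> run P k st = st'.
Proof.
elim: k st => [st [->] //|k IH st] /=.
by case: (step P st) => [st1|] //=; apply: IH.
Qed.

Definition code_at (P : program) (o : nat) (l : program) : Prop :=
  forall k, k < size l -> nth IHalt P (o + k) = nth IHalt l k.

Lemma code_at_cat P o l1 l2 :
  code_at P o (l1 ++ l2) -> code_at P o l1 /\ code_at P (o + size l1) l2.
Proof.
move=> h; split=> k kl.
  by rewrite h ?size_cat ?nth_cat ?kl // ltn_addr.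
rewrite -addnA h ?size_cat ?ltn_add2l // nth_cat.
by rewrite ltnNge leq_addr /= addKn.
Qed.

Lemma code_at_cons P o i l :
  code_at P o (i :: l) -> nth IHalt P o = i /\ code_at P o.+1 l.
Proof.
move=> h; split; first by rewrite -[o]addn0 h.
by move=> k kl; rewrite addSnnS h.
Qed.

Lemma code_at_middle l1 l2 l3 : code_at (l1 ++ l2 ++ l3) (size l1) l2.
Proof.
by move=> k kl; rewrite nth_cat ltnNge leq_addr /= addKn nth_cat kl.
Qed.

Definition sinstr (i : instr) (R : regs) : regs :=
  match i with
  | IConst r c => upd R r c
  | IAdd r a b => upd R r (R a + R b)
  | ISub r a b => upd R r (R a - R b)
  | ILoad r a => upd R r (R (R a))
  | IStore a r => upd R (R a) (R r)
  | _ => R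
  end.

Definition straight (i : instr) : bool :=
  match i with IJz _ _ | IHalt => false | _ => true end.

Definition srun (l : program) (R : regs) : regs := foldl (fun R i => sinstr i R) R l.

Lemma srun_cat l1 l2 R : srun (l1 ++ l2) R = srun l2 (srun l1 R).
Proof. exact: foldl_cat. Qed.

Lemma nsteps_straight P o l R :
  all straight l -> code_at P o l ->
  nsteps P (size l) (o, R) = Some (o + size l, srun l R).
Proof.
elim: l o R => [|i l IH] o R /=; first by rewrite addn0.
case/andP=> si sl /code_at_cons [hi /IH {}IH].
by rewrite hi -addSnnS; case: i si {hi} => //= *; apply: IH.
Qed.

Lemma straight_cexp e d : all straight (cexp e d).
Proof.
elim: e d => [c|r|a IHa b IHb|a IHa b IHb|j a IHa] d //=;
  by rewrite !all_cat ?IHa ?IHb.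
Qed.

(** Registers 1 to 15 are left unconstrained, so code that touches only temporaries preserves the
    relation. *)
Definition sim (b : nat) (s : store) (R : regs) : Prop :=
  [/\ R 0 = b, forall r, r < 48 -> R (r + 16) = s.1 r &
      forall j x, j < 16 -> R (b + 16 * x + j) = s.2 j x].

Lemma upd_same R k v : upd R k v k = v.
Proof. by rewrite /upd eqxx. Qed.

Lemma upd_other R k v x : x != k -> upd R k v x = R x.
Proof. by rewrite /upd => /negbTE ->. Qed.

Section Compile.
Variables (b : nat) (b_ge : 64 <= b).

Lemma sim_low s R R' : sim b s R ->
  (forall x, (x == 0) || (16 <= x) -> R' x = R x) -> sim b s R'.
Proof.
case=> h0 hv ha h; split; first by rewrite h.
  by move=> r /hv <-; rewrite h //; lia.
by move=> j x /(ha j x) <-; rewrite h //; lia.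
Qed.

(** The second conjunct carries the induction: a left operand stored at [d] survives the evaluation
    of the right operand at [d.+1]. *)
Lemma cexp_correct e d s R : 0 < d -> wfe e d -> sim b s R ->
  srun (cexp e d) R d = eval e s /\
  (forall x, (x < d) || (16 <= x) -> srun (cexp e d) R x = R x).
Proof.
have low d' R1 R2 : 0 < d' -> sim b s R1 ->
    (forall x, (x < d') || (16 <= x) -> R2 x = R1 x) -> sim b s R2.
  by move=> d0 /sim_low hs h; apply: hs => x hx; apply: h; lia.
have two op (Iop : nat -> nat -> nat -> instr) a1 a2 :
    (forall r x y R', sinstr (Iop r x y) R' = upd R' r (op (R' x) (R' y))) ->
    (forall d R, 0 < d -> wfe a1 d -> sim b s R ->
      srun (cexp a1 d) R d = eval a1 s /\
      (forall x, (x < d) || (16 <= x) -> srun (cexp a1 d) R x = R x)) ->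
    (forall d R, 0 < d -> wfe a2 d -> sim b s R ->
      srun (cexp a2 d) R d = eval a2 s /\
      (forall x, (x < d) || (16 <= x) -> srun (cexp a2 d) R x = R x)) ->
    forall d R, 0 < d -> wfe a1 d && wfe a2 d.+1 -> d < 16 -> sim b s R ->
    let R' := srun (cexp a1 d ++ cexp a2 d.+1 ++ [:: Iop d d d.+1]) R in
    R' d = op (eval a1 s) (eval a2 s) /\
    (forall x, (x < d) || (16 <= x) -> R' x = R x).
  move=> hop IH1 IH2 {}d {}R d0 /andP[w1 w2] d16 hs.
  rewrite !srun_cat /=.
  have [e1 f1] := IH1 d R d0 w1 hs.
  have [e2 f2] := IH2 d.+1 _ isT w2 (low d _ _ d0 hs f1).
  rewrite /= hop; split; first by rewrite upd_same e2 f2 ?ltnSn // e1.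
  by move=> x hx; rewrite upd_other ?f2 ?f1 //; lia.
have wlt e' d' : wfe e' d' -> d' < 16.
  elim: e' d' => //= [r|a IHa c _|a IHa c _|j a _] d'; last by lia.
  - by case/andP.
  - by case/andP=> /IHa.
  - by case/andP=> /IHa.
elim: e d R => [c|r|a1 IH1 a2 IH2|a1 IH1 a2 IH2|j a IHa] d R d0 /= wf hs.
- split; first by rewrite upd_same.
  by move=> x hx; rewrite upd_other //; lia.
- case/andP: wf => d16 r48; have [_ hv _] := hs; split.
    by rewrite !upd_same upd_other ?hv ?addn0 //; lia.
  by move=> x hx; rewrite !upd_other //; lia.
- apply: (two addn IAdd) => //.
  by case/andP: wf => /wlt.
- apply: (two subn ISub) => //.
  by case/andP: wf => /wlt.
- case/and3P: wf => wa d15 j16.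
  have [e1 f1] := IHa d R d0 wa hs.
  have [h0 _ ha] := hs.
  rewrite srun_cat /=.
  set R1 := srun _ _ in e1 f1 *.
  have R10 : R1 0 = b by rewrite f1 ?d0.
  set T := upd _ d.+1 j.
  have Td : T d = b + 16 * eval a s.
    have dd : d != d.+1 by lia.
    have od : 0 != d by lia.
    rewrite /T upd_other // !upd_same !(upd_other _ _ od) R10 e1; lia.
  have Td1 : T d.+1 = j by rewrite /T upd_same.
  have Tx x : x != d -> x != d.+1 -> T x = R1 x.
    by move=> h1 h2; rewrite /T !upd_other.
  split.
    rewrite !upd_same Td Td1 upd_other; last by lia.
    rewrite Tx ?f1 ?ha //; lia.
  move=> x hx; rewrite !upd_other ?Tx ?f1 //; lia.
Qed.

Lemma cprim_correct c s R : wfc c -> sim b s R ->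
  match c with
  | CAsg r e => sim b (setr s r (eval e s)) (srun (cprim c) R)
  | CSto j a e => sim b (seta s j (eval a s) (eval e s)) (srun (cprim c) R)
  | _ => True
  end.
Proof.
case: c => // [r e /andP[we r48]|j a e /and3P[wa we j16]] hs;
  rewrite /cprim !srun_cat.
  have [e1 f1] := cexp_correct (isT : 0 < 1) we hs.
  have [h0 hv ha] := sim_low hs (fun x hx => f1 x ltac:(lia)).
  rewrite /= upd_same addn0; split => /=.
  - by rewrite !upd_other //; lia.
  - move=> r' r'48; rewrite /upd eqn_add2r; case: eqP => [//|_].
    by rewrite (negbTE (_ : r' + 16 != 2)) ?hv //; lia.
  - by move=> j x j16; rewrite !upd_other ?ha //; lia.
have [e1 f1] := cexp_correct (isT : 0 < 1) wa hs.
have hs1 := sim_low hs (fun x hx => f1 x ltac:(lia)).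
set R1 := srun _ _ in e1 f1 hs1 *.
have R10 : R1 0 = b by case: hs1.
set R2 := (X in srun (cexp e 2) X).
have R21 : R2 1 = b + 16 * eval a s + j.
  rewrite /R2 /= /upd /= R10 e1; lia.
have R2x x : x != 1 -> x != 2 -> R2 x = R1 x.
  by move=> x1 x2; rewrite /R2 /= !upd_other.
have hs2 : sim b s R2 by apply: (sim_low hs1) => x hx; apply: R2x; lia.
have [e2 f2] := cexp_correct (isT : 0 < 2) we hs2.
have [h0 hv ha] := sim_low hs2 (fun x hx => f2 x ltac:(lia)).
rewrite /= e2 f2 // R21; split=> /=.
- by rewrite upd_other //; lia.
- by move=> r r48; rewrite upd_other ?hv //; lia.
- move=> j' x j'16; rewrite /upd.
  case: (altP (j' =P j)) => [->|jj].
    by rewrite eqn_add2r eqn_add2l eqn_mul2l /=; case: eqP => // _; rewrite ha.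
  rewrite (negbTE (_ : _ != b + 16 * eval a s + j)) ?ha //.
  apply/negP => /eqP; move/eqP: jj; lia.
Qed.

Fixpoint tb (Y : nat) (c : com) : nat :=
  match c with
  | CAsg _ _ | CSto _ _ _ => csz c
  | CSeq c1 c2 => tb Y c1 + tb Y c2
  | CIf e c1 c2 => tb Y c1 + tb Y c2 + ecsz e + 3
  | CWhile e c1 => Y * (tb Y c1 + ecsz e + 3) + (ecsz e + 1)
  end.

Lemma ccom_correct Y c P o s R Q : wfc c ->
  code_at P o (ccom c o) -> sim b s R -> wp Y c Q s ->
  exists k R' s', [/\ k <= tb Y c, nsteps P k (o, R) = Some (o + csz c, R'),
                      sim b s' R' & Q s'].
Proof.
elim: c o s R Q => [r e|j a e|c1 IH1 c2 IH2|e c1 IH1 c2 IH2|e c1 IH1] o s R Q wf hc hs.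
- move=> hq; have h := cprim_correct wf hs.
  exists (csz (CAsg r e)), (srun (cprim (CAsg r e)) R), (setr s r (eval e s)).
  split=> //; rewrite -[csz _](size_ccom _ o); apply: nsteps_straight => //.
  by rewrite /= all_cat straight_cexp.
- move=> hq; have h := cprim_correct wf hs.
  exists (csz (CSto j a e)), (srun (cprim (CSto j a e)) R),
         (seta s j (eval a s) (eval e s)).
  split=> //; rewrite -[csz _](size_ccom _ o); apply: nsteps_straight => //.
  by rewrite /= !(all_cat, straight_cexp) /= all_cat straight_cexp.
- case/andP: wf => wf1 wf2; case/code_at_cat: hc; rewrite size_ccom => hc1 hc2 /= hq.
  have [k1 [R1 [s1 [kk1 n1 hs1 hq1]]]] := IH1 _ _ _ _ wf1 hc1 hs hq.
  have [k2 [R2 [s2 [kk2 n2 hs2 hq2]]]] := IH2 _ _ _ _ wf2 hc2 hs1 hq1.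
  exists (k1 + k2), R2, s2; split=> //; first by rewrite leq_add.
  by rewrite addnA; apply: nsteps_cat n1 n2.
- case/and3P: wf => we wf1 wf2.
  have [e1 f1] := cexp_correct (isT : 0 < 1) we hs.
  have hs0 := sim_low hs (fun x hx => f1 x ltac:(lia)).
  move: hc; rewrite [ccom _ _]/=.
  case/code_at_cat; rewrite size_cexp => hce.
  have := @nsteps_straight P o _ R (straight_cexp e 1) hce.
  set R1 := srun _ _ in e1 f1 hs0 *.
  rewrite size_cexp => n1 /code_at_cons [hj].
  case/code_at_cat; rewrite size_ccom -(addn1 (o + _)) => hc1.
  move=> /code_at_cons [hj1] /code_at_cons [hj2].
  have -> : (o + ecsz e + 1 + csz c1).+2 = o + ecsz e + 1 + csz c1 + 2 by lia.
  move=> hc2 /=; case: eqP => ev0 hq.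
    have [k2 [R2 [s2 [kk2 n2 hs2 hq2]]]] := IH2 _ _ _ _ wf2 hc2 hs0 hq.
    exists (ecsz e + k2.+1), R2, s2; split=> //; first by lia.
    apply: nsteps_cat n1 _ => /=; rewrite hj e1 ev0 /= n2; congr (Some (_, _)); lia.
  have [k2 [R2 [s2 [kk2 n2 hs2 hq2]]]] := IH1 _ _ _ _ wf1 hc1 hs0 hq.
  exists (ecsz e + (k2 + 2).+1), (upd R2 1 0), s2; split=> //; first by lia.
    apply: nsteps_cat n1 _ => /=; rewrite hj e1 (negbTE (introN eqP ev0)) /= -(addn1 (o + _)).
    by apply: nsteps_cat n2 _; rewrite /= hj1 /= hj2 /=.
  by apply: (sim_low hs2) => x hx; rewrite upd_other //; lia.
- case/andP: wf => we wf1 [n]; rewrite [tb _ _]/=.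
  (* The time budget is stated with the actual number [n] of iterations in place of [Y], so that
     induction on [n] charges each pass separately. *)
  suff : wloop (wp Y c1) e Q n s ->
    exists k R' s', [/\ k <= n * (tb Y c1 + ecsz e + 3) + (ecsz e + 1),
      nsteps P k (o, R) = Some (o + csz (CWhile e c1), R'), sim b s' R' & Q s'].
    move=> h nY /h [k [R' [s' [hk h1 h2 h3]]]]; exists k, R', s'; split=> //.
    by apply: leq_trans hk _; rewrite leq_add2r leq_mul2r nY orbT.
  elim: n s R hs => [|n IHn] s R hs.
    case=> ev0 hq.
    have [e1 f1] := cexp_correct (isT : 0 < 1) we hs.
    have hs0 := sim_low hs (fun x hx => f1 x ltac:(lia)).
    move: (hc); rewrite [ccom _ _]/=.
    case/code_at_cat; rewrite size_cexp => hce.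
    have := @nsteps_straight P o _ R (straight_cexp e 1) hce.
    set R1 := srun _ _ in e1 f1 hs0 *.
    rewrite size_cexp => n1 /code_at_cons [hj _].
    exists (ecsz e + 1), R1, s; split=> //.
    by apply: nsteps_cat n1 _; rewrite /= hj e1 ev0.
  case=> ev0 hq.
  have [e1 f1] := cexp_correct (isT : 0 < 1) we hs.
  have hs0 := sim_low hs (fun x hx => f1 x ltac:(lia)).
  move: (hc); rewrite [ccom _ _]/=.
  case/code_at_cat; rewrite size_cexp => hce.
  have := @nsteps_straight P o _ R (straight_cexp e 1) hce.
  set R1 := srun _ _ in e1 f1 hs0 *.
  rewrite size_cexp => n1 /code_at_cons [hj].
  case/code_at_cat; rewrite size_ccom -(addn1 (o + _)) => hc1.
  move=> /code_at_cons [hj1] /code_at_cons [hj2] _.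
  have [k2 [R2 [s2 [kk2 n2 hs2 hq2]]]] := IH1 _ _ _ _ wf1 hc1 hs0 hq.
  have hs3 : sim b s2 (upd R2 1 0).
    by apply: (sim_low hs2) => x hx; rewrite upd_other //; lia.
  have [k3 [R3 [s3 [kk3 n3 hs4 hq3]]]] := IHn _ _ hs3 hq2.
  exists (ecsz e + (k2 + k3.+2).+1), R3, s3; split=> //; first by lia.
  apply: nsteps_cat n1 _ => /=; rewrite hj e1 (negbTE (introN eqP ev0)) /= -(addn1 (o + _)).
  by apply: nsteps_cat n2 _; rewrite /= hj1 /= hj2.
Qed.

End Compile.

(** * The running time as a fixed power of [Y] *)

(** An exponent for [tb]: sums are bounded by products, so exponents add up, and the factor [Y] of a
    loop contributes 1. *)
Fixpoint dg (c : com) : nat :=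
  match c with
  | CAsg _ _ | CSto _ _ _ => csz c
  | CSeq c1 c2 => dg c1 + dg c2
  | CIf e c1 c2 => dg c1 + dg c2 + ecsz e + 3
  | CWhile e c1 => 1 + (dg c1 + ecsz e + 3) + (ecsz e + 1)
  end.

(** Both powers are at least 2, and the sum of two such numbers is at most their product. *)
Lemma leq_add_expn Y a c x y : 1 < Y -> 0 < x -> 0 < y ->
  a <= Y ^ x -> c <= Y ^ y -> a + c <= Y ^ (x + y).
Proof.
move=> Y1 x0 y0 ha hc; apply: leq_trans (leq_add ha hc) _; rewrite expnD.
have gt1 z : 0 < z -> 1 < Y ^ z by move=> z0; rewrite -(exp1n z) ltn_exp2r.
have := gt1 x x0; have := gt1 y y0; nia.
Qed.

Lemma tb_dg Y c : 1 < Y -> tb Y c <= Y ^ dg c.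
Proof.
move=> Y1.
have lin z : z <= Y ^ z by apply: ltnW; apply: ltn_expl.
have ez e : 0 < ecsz e by elim: e => //= *; lia.
have pos c' : 0 < dg c'.
  by elim: c' => //= *; have := ez; lia.
elim: c => [r e|j a e|c1 IH1 c2 IH2|e c1 IH1 c2 IH2|e c1 IH1] //=;
  first by apply: leq_add_expn => //; apply: pos.
- by do 3 (apply: leq_add_expn => //; rewrite ?addn_gt0 ?pos ?ez //).
- apply: leq_add_expn => //; rewrite ?addn_gt0 ?ez ?orbT //.
  rewrite expnD expn1 leq_mul2l; apply/orP; right.
  by do 2 (apply: leq_add_expn => //; rewrite ?addn_gt0 ?pos ?ez //).
Qed.

(** * Moving the input out of the way of the variables *)

(** Unrolled, because no register is free for a loop counter until the low registers are saved. *)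
Definition save_low (k : nat) : program :=
  flatten [seq [:: IAdd 0 0 3; IStore 0 r] | r <- iota 1 k].

Lemma save_low_correct b k R : R 0 = b -> R 3 = 16 -> k < b -> 3 < b ->
  let R' := srun (save_low k) R in
  [/\ R' 0 = b + 16 * k, forall x, 0 < x < b -> R' x = R x &
      forall j, 0 < j <= k -> R' (b + 16 * j) = R j].
Proof.
move=> R0 R3; elim: k => [|k IH] kb b3.
  by split=> //= [|j]; [rewrite muln0 addn0 | lia].
have [h0 hx hj] := IH (ltnW kb) b3.
have -> : save_low k.+1 = save_low k ++ [:: IAdd 0 0 3; IStore 0 k.+1].
  by rewrite /save_low -(addn1 k) iotaD map_cat flatten_cat /= add1n addn1.
rewrite srun_cat /=; move: h0 hx hj; set R1 := srun _ R => h0 hx hj.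
have e0 : upd R1 0 (R1 0 + R1 3) 0 = b + 16 * k.+1.
  rewrite upd_same h0 hx ?R3; lia.
rewrite e0; split.
- rewrite upd_other ?e0 //; lia.
- by move=> x hx1; rewrite !upd_other ?hx //; lia.
- move=> j hj1; case: (altP (j =P k.+1)) => [->|jk].
    by rewrite upd_same upd_other ?hx //; lia.
  rewrite !upd_other ?hj //; move/eqP: jk; lia.
Qed.

(* Initially the input fills the registers 1 to L, where the compiled code keeps
   its variables; only register 0 and, since it holds the diagonal entry adj 0 0,
   register 3 can be overwritten at once. *)
Definition prelude1 (k : nat) : program :=
  [:: IConst 3 64; IAdd 0 0 3; IConst 3 16] ++ save_low k ++
  [:: IConst 1 (16 * k); ISub 2 0 1; IConst 1 64; ISub 4 2 1; IConst 5 k].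
(** A loop is possible now, since the low registers have been saved. The address 134 is the length
    of [prelude1 63], where the loop starts, and 143 is the instruction after it. *)
Definition prelude2 : program :=
  [:: ISub 6 4 5; IJz 6 143; IConst 1 1; IAdd 5 5 1; IAdd 0 0 3; ILoad 6 5;
      IStore 0 6; IConst 6 0; IJz 6 134].
Definition prelude3 : program := [:: IConst 1 0; IAdd 16 4 1; IAdd 0 2 1].
Definition prelude : program := prelude1 63 ++ prelude2 ++ prelude3.

(** Here 146 is the length of [prelude], and register 17 is variable 1, which holds the answer. *)
Definition compile (c : com) : program :=
  prelude ++ ccom c 146 ++ [:: IConst 1 0; IAdd 0 17 1; IHalt].

Definition loaded (inp : seq nat) (s : store) : Prop :=
  s.1 0 = size inp /\
  forall j, 0 < j <= size inp -> j != 3 -> s.2 0 j = nth 0 inp j.-1.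

(** Copies go to addresses above [L + 64], so input that is still to be moved is never
    overwritten. *)
Lemma prelude2_correct P b L (R0 R : regs) n j :
  code_at P 134 prelude2 -> b = L + 64 -> 63 <= j -> L - j = n ->
  [/\ R 0 = b + 16 * j, R 2 = b, R 3 = 16, R 4 = L & R 5 = j] ->
  (forall x, 64 <= x <= L -> R x = R0 x) ->
  (forall i, 0 < i <= j -> i <= L -> i != 3 -> R (b + 16 * i) = R0 i) ->
  exists2 R', nsteps P (9 * n + 2) (134, R) = Some (143, R') &
  [/\ R' 2 = b, R' 4 = L &
     forall i, 0 < i <= L -> i != 3 -> R' (b + 16 * i) = R0 i].
Proof.
move=> hc bL; elim: n j R => [|n IH] j R j63 hn [r0 r2 r3 r4 r5] hx ha.
  have [c0 /code_at_cons [c1 _]] := code_at_cons hc.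
  exists (upd R 6 0); first by rewrite /= c0 /= r4 r5 hn c1.
  split=> // i hi i3.
  by rewrite upd_other ?ha //; lia.
have [c0 /code_at_cons [c1 /code_at_cons [c2 /code_at_cons [c3
  /code_at_cons [c4 /code_at_cons [c5 /code_at_cons [c6 /code_at_cons [c7
  /code_at_cons [c8 _]]]]]]]]] := code_at_cons hc.
set R1 := upd R 6 n.+1.
set R2 := upd R1 1 1.
set R3 := upd R2 5 j.+1.
set R4 := upd R3 0 (b + 16 * j.+1).
set R5 := upd R4 6 (R0 j.+1).
set R6 := upd R5 (b + 16 * j.+1) (R0 j.+1).
set R7 := upd R6 6 0.
have n1 : nsteps P 9 (134, R) = Some (134, R7).
  rewrite /= c0 /= r4 r5 hn -/R1 c1 /= c2 /= -/R2 c3 /=.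
  have -> : R2 5 + R2 1 = j.+1 by rewrite /R2 /R1 /upd /= r5 addn1.
  rewrite -/R3 c4 /=.
  have -> : R3 0 + R3 3 = b + 16 * j.+1 by rewrite /R3 /R2 /R1 /upd /= r0 r3; lia.
  rewrite -/R4 c5 /=.
  have -> : R4 (R4 5) = R0 j.+1.
    have -> : R4 5 = j.+1 by [].
    rewrite /R4 /R3 /R2 /R1 !upd_other ?hx //; lia.
  rewrite -/R5 c6 /=.
  have -> : R5 0 = b + 16 * j.+1 by [].
  by rewrite -/R6 c7 /= -/R7 c8.
have b64 : 64 <= b by lia.
have R7x x : x != 6 -> x != b + 16 * j.+1 -> x != 0 -> x != 5 -> x != 1 -> R7 x = R x.
  by move=> *; rewrite /R7 /R6 /R5 /R4 /R3 /R2 /R1 !upd_other.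
have [] := IH j.+1 R7.
- lia.
- lia.
- split; try by rewrite R7x //; lia.
    rewrite /R7 upd_other // /R6 upd_other //; lia.
  rewrite /R7 upd_other // /R6 upd_other //; lia.
- by move=> x hx1; rewrite R7x ?hx //; lia.
- move=> i hi1 iL i3; case: (altP (i =P j.+1)) => [->|ij].
    rewrite /R7 upd_other; last by lia.
    by rewrite /R6 upd_same.
  rewrite R7x ?ha //; move/eqP: ij; lia.
move=> R' n2 h; exists R' => //.
have -> : 9 * n.+1 + 2 = 9 + (9 * n + 2) by lia.
exact: nsteps_cat n1 n2.
Qed.

Lemma prelude1_correct P L k (R0 : regs) :
  code_at P 0 (prelude1 k) -> R0 0 = L -> k < 64 ->
  exists2 R, nsteps P (size (prelude1 k)) (0, R0) = Some (size (prelude1 k), R) &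
  [/\ R 0 = L + 64 + 16 * k, R 2 = L + 64, R 3 = 16, R 4 = L &
  [/\ R 5 = k, forall x, 64 <= x <= L -> R x = R0 x &
      forall i, 0 < i <= k -> i <= L -> i != 3 -> R (L + 64 + 16 * i) = R0 i]].
Proof.
move=> hc R00 k64.
have st : all straight (prelude1 k).
  have h j : all straight (flatten [seq [:: IAdd 0 0 3; IStore 0 r] | r <- iota j k]).
    by elim: k j {hc k64} => //= k IH j; apply: IH.
  by rewrite /prelude1 !all_cat /= andbT; apply: h.
exists (srun (prelude1 k) R0); first exact: (nsteps_straight _ st hc).
rewrite /prelude1 srun_cat srun_cat.
set l1 := (X in srun X R0); set R1 := srun l1 R0.
have R1x x : x != 0 -> x != 3 -> R1 x = R0 x by move=> *; rewrite /R1 /= !upd_other.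
have R10 : R1 0 = L + 64 by rewrite /R1 /= /upd /= R00.
have R13 : R1 3 = 16 by rewrite /R1 /= /upd /=.
have [||] := @save_low_correct (L + 64) k R1 R10 R13; try lia.
set R2 := srun _ R1 => h0 hx hj; clearbody R2 R1.
rewrite /= /upd /=; split; first by rewrite h0.
- by rewrite h0 addnK.
- by rewrite hx ?R13 //; lia.
- by rewrite h0 addnK addnK.
split=> //.
- move=> x hx1; rewrite !(introF eqP) ?hx ?R1x //; lia.
- move=> i hi iL i3; rewrite !(introF eqP) ?hj ?R1x //; lia.
Qed.

Lemma prelude_correct P L (R0 : regs) :
  code_at P 0 prelude -> R0 0 = L ->
  exists k R, [/\ k <= 139 + 9 * L, nsteps P k (0, R0) = Some (146, R),
    R 0 = L + 64, R 16 = L &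
    forall i, 0 < i <= L -> i != 3 -> R (L + 64 + 16 * i) = R0 i].
Proof.
case/code_at_cat => hp1 /code_at_cat [].
have sz1 : size (prelude1 63) = 134 by [].
rewrite add0n sz1 (_ : 134 + size prelude2 = 143) // => hp2 hp3 R00.
have [R3 n1 [r0 r2 r3 r4 [r5 rx ra]]] := prelude1_correct hp1 R00 isT.
have [R4 n2 [s2 s4 sa]] := @prelude2_correct P (L + 64) L R0 R3 (L - 63) 63 hp2
  erefl isT erefl (And5 r0 r2 r3 r4 r5) rx ra.
have n3 := @nsteps_straight P 143 prelude3 R4 isT hp3.
exists (134 + (9 * (L - 63) + 2) + 3), (srun prelude3 R4).
rewrite sz1 in n1; have n := nsteps_cat (nsteps_cat n1 n2) n3.
clear n1 n2 n3 r0 r2 r3 r4 r5 rx ra sz1 hp1 hp2 hp3.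
split; first by lia.
- exact: n.
- by rewrite /= /upd /= s2 addn0.
- by rewrite /= /upd /= s4 addn0.
- move=> i hi i3; rewrite /= !upd_other ?sa //; lia.
Qed.

Lemma compile_correct c inp Y (Q : store -> Prop) : wfc c ->
  (forall s, loaded inp s -> wp Y c Q s) ->
  exists s, Q s /\
  halts_within (compile c) inp (141 + 9 * size inp + tb Y c) (s.1 1).
Proof.
move=> wf hq; set P := compile c.
have cc := @code_at_middle [::] P [::]; rewrite cats0 /= in cc.
move: (cc); rewrite {2}/P /compile => /code_at_cat [hp].
have sz : size prelude = 146 by [].
rewrite add0n sz => /code_at_cat [hcc].
rewrite size_ccom => hend.
have [d1 d2] := @code_at_cat P _ [:: IConst 1 0; IAdd 0 17 1] [:: IHalt] hend.
have [{}d2 _] := code_at_cons d2.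
have [k0 [R [hk0 n0 r0 r16 ra]]] :=
  @prelude_correct P (size inp) (init_state inp).2 hp erefl.
clearbody P; clear cc hp hend sz.
set b := size inp + 64 in r0 ra.
(* Every register file simulates the store read off from it, so nothing has to be cleared; in
   return, programs may not rely on initial zeros. *)
pose s : store := (fun r => R (r + 16), fun j x => R (b + 16 * x + j)).
have hs : sim b s R by split.
have hl : loaded inp s.
  split; first exact: r16.
  move=> j hj1 j3; rewrite /s /= addn0 ra //.
  by case: j hj1 {j3}.
have b64 : 64 <= b by rewrite /b leq_addl.
have [k [R' [s' [kk n4 hs' hq']]]] := ccom_correct b64 wf hcc hs (hq _ hl).
exists s'; split=> //.
have n5 := @nsteps_straight P _ [:: IConst 1 0; IAdd 0 17 1] R' isT d1.
have n := nsteps_cat (nsteps_cat n0 n4) n5.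
exists (k0 + k + 2); rewrite (run_nsteps n); split; first by lia.
  by rewrite /= d2.
by rewrite /= /upd /= addn0; case: hs' => _ /(_ 1 isT).
Qed.

(** * Program logic *)

Local Notation "c1 ;; c2" := (CSeq c1 c2) (at level 90, right associativity).
Local Notation "r ::= e" := (CAsg r e) (at level 80).
Local Notation "a :+ b" := (EAdd a b) (at level 50, left associativity).
Local Notation "a :- b" := (ESub a b) (at level 50, left associativity).

Fixpoint wr (c : com) : seq nat :=
  match c with
  | CAsg r _ => [:: r]
  | CSto _ _ _ => [::]
  | CSeq c1 c2 | CIf _ c1 c2 => wr c1 ++ wr c2
  | CWhile _ c1 => wr c1
  end.

Fixpoint aw (c : com) : seq nat :=
  match c with
  | CAsg _ _ => [::]
  | CSto j _ _ => [:: j]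
  | CSeq c1 c2 | CIf _ c1 c2 => aw c1 ++ aw c2
  | CWhile _ c1 => aw c1
  end.

Definition fr (W A : seq nat) (s s' : store) : Prop :=
  (forall r, r \notin W -> s'.1 r = s.1 r) /\ (forall j, j \notin A -> s'.2 j = s.2 j).

Lemma fr_refl W A s : fr W A s s.
Proof. by []. Qed.

Lemma fr_trans W A s1 s2 s3 : fr W A s1 s2 -> fr W A s2 s3 -> fr W A s1 s3.
Proof.
move=> [h1 h2] [g1 g2]; split=> r hr; first by rewrite g1 // h1.
by rewrite g2 // h2.
Qed.

Lemma fr_sub W A W' A' s s' : fr W A s s' ->
  {subset W <= W'} -> {subset A <= A'} -> fr W' A' s s'.
Proof.
by move=> [h1 h2] sW sA; split=> r hr; [apply: h1 | apply: h2];
  apply: contra hr => ?; [apply: sW | apply: sA].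
Qed.

Lemma fr_setr W A s s' r v : fr W A s s' -> r \in W -> fr W A s (setr s' r v).
Proof.
move=> [h1 h2] rW; split=> // x xW /=; rewrite upd_other ?h1 //.
by apply: contraNneq xW => ->.
Qed.

Lemma wloop_conseq W e (Q Q' : store -> Prop) n s :
  (forall (P P' : store -> Prop) s', (forall s2, P s2 -> P' s2) -> W P s' -> W P' s') ->
  (forall s', Q s' -> Q' s') -> wloop W e Q n s -> wloop W e Q' n s.
Proof.
move=> hW h; elim: n s => [|n IHn] s [ev]; first by move=> /h.
by move=> hw; split=> //; apply: hW hw.
Qed.

Lemma wp_conseq Y c (Q Q' : store -> Prop) s :
  (forall s', Q s' -> Q' s') -> wp Y c Q s -> wp Y c Q' s.
Proof.
elim: c Q Q' s => [r e|j a e|c1 IH1 c2 IH2|e c1 IH1 c2 IH2|e c1 IH1] Q Q' s h /=.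
- exact: h.
- exact: h.
- by apply: IH1 => s'; apply: IH2.
- by case: eqP => _; [apply: IH2 | apply: IH1].
- by case=> n nY hn; exists n => //; apply: wloop_conseq hn => // P P' s'; apply: IH1.
Qed.

(** Specifications may thus mention only what a command computes; whatever lies outside its
    syntactic write sets is carried over. *)
Lemma wp_frame Y c Q s :
  wp Y c Q s -> wp Y c (fun s' => Q s' /\ fr (wr c) (aw c) s s') s.
Proof.
elim: c Q s => [r e|j a e|c1 IH1 c2 IH2|e c1 IH1 c2 IH2|e c1 IH1] Q s /=.
- by move=> h; split=> //; apply: fr_setr; rewrite ?inE.
- move=> h; split=> //; split=> // k; rewrite inE /= => /negbTE -> //.
- move=> /IH1; apply: wp_conseq => s1 [/IH2 h2 f1].
  apply: wp_conseq h2 => s2 [h f2]; split=> //; apply: fr_trans.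
    by apply: fr_sub f1 _ _ => x xW; rewrite mem_cat xW.
  by apply: fr_sub f2 _ _ => x xW; rewrite mem_cat xW orbT.
- case: eqP => _; [move=> /IH2 | move=> /IH1]; apply: wp_conseq => s1 [h f1].
    by split=> //; apply: fr_sub f1 _ _ => x xW; rewrite mem_cat xW orbT.
  by split=> //; apply: fr_sub f1 _ _ => x xW; rewrite mem_cat xW.
- case=> n nY hn; exists n => //; elim: n s {nY} hn => [|n IHn] s [ev] h.
    by [].
  split=> //; have := IH1 _ _ h; apply: wp_conseq => s1 [/IHn h1 f1].
  apply: wloop_conseq h1 => [P P' s'|s2 [h2 f2]]; first exact: wp_conseq.
  by split=> //; apply: fr_trans f1 f2.
Qed.

Lemma wp_use Y c (P Q : store -> Prop) s :
  wp Y c P s -> (forall s', fr (wr c) (aw c) s s' -> P s' -> Q s') -> wp Y c Q s.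
Proof. by move=> /wp_frame h h1; apply: wp_conseq h => s' [h2 h3]; apply: h1. Qed.

Lemma wp_while Y e c (I : nat -> store -> Prop) Q s n :
  n <= Y -> I n s ->
  (forall k s', I k.+1 s' -> eval e s' <> 0 /\ wp Y c (I k) s') ->
  (forall s', I 0 s' -> eval e s' = 0 /\ Q s') ->
  wp Y (CWhile e c) Q s.
Proof.
move=> nY hn hS h0; exists n => //; elim: n s {nY} hn => [|n IHn] s hn; first exact: h0.
by have [? h] := hS _ _ hn; split=> //; apply: wp_conseq h.
Qed.

Lemma wp_seq Y c1 c2 Q s : wp Y c1 (wp Y c2 Q) s -> wp Y (c1 ;; c2) Q s.
Proof. by []. Qed.

Lemma wp_asg Y r e Q s : Q (setr s r (eval e s)) -> wp Y (r ::= e) Q s.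
Proof. by []. Qed.

Lemma wp_sto Y j a e Q s :
  Q (seta s j (eval a s) (eval e s)) -> wp Y (CSto j a e) Q s.
Proof. by []. Qed.

Lemma wp_if Y e c1 c2 Q s :
  (eval e s <> 0 -> wp Y c1 Q s) -> (eval e s = 0 -> wp Y c2 Q s) ->
  wp Y (CIf e c1 c2) Q s.
Proof. by move=> h1 h2 /=; case: eqP; [apply: h2 | apply: h1]. Qed.

Ltac wseq := apply: wp_seq.
Ltac wasg := refine (@wp_asg _ _ _ _ _ _); cbv beta.
Ltac wsto := refine (@wp_sto _ _ _ _ _ _ _); cbv beta.

Fixpoint indep (e : expr) (W A : seq nat) : bool :=
  match e with
  | EC _ => true
  | EV r => r \notin W
  | EAdd a b | ESub a b => indep a W A && indep b W A
  | ELd j a => (j \notin A) && indep a W A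
  end.

Lemma eval_indep e W A s s' : indep e W A -> fr W A s s' -> eval e s' = eval e s.
Proof.
move=> + [h1 h2]; elim: e => //= [a IHa b IHb|a IHa b IHb|j a IHa].
- by case/andP=> /IHa -> /IHb ->.
- by case/andP=> /IHa -> /IHb ->.
- by case/andP=> /h2 -> /IHa ->.
Qed.

Definition CFor (i : nat) (N : expr) (c : com) : com :=
  i ::= EC 0 ;; CWhile (N :- EV i) (c ;; i ::= EV i :+ EC 1).

Lemma wp_for (J : nat -> store -> Prop) Y i N c Q s :
  i \notin wr c -> indep N (i :: wr c) (aw c) -> eval N s <= Y ->
  J 0 (setr s i 0) ->
  (forall k s', k < eval N s -> fr (i :: wr c) (aw c) s s' -> s'.1 i = k ->
     J k s' -> wp Y c (fun s2 => J k.+1 (setr s2 i k.+1)) s') ->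
  (forall s', fr (i :: wr c) (aw c) s s' -> J (eval N s) s' -> Q s') ->
  wp Y (CFor i N c) Q s.
Proof.
move=> ic iN NY h0 hS hQ; rewrite /CFor /=.
set M := eval N s in NY hS hQ.
(* [wp_while] counts the remaining iterations, while [J] counts the completed ones. *)
pose I n s' := [/\ n <= M, fr (i :: wr c) (aw c) s s', s'.1 i = M - n & J (M - n) s'].
change (wp Y (CWhile (N :- EV i) (c ;; i ::= EV i :+ EC 1)) Q (setr s i 0)).
apply: (@wp_while _ _ _ I _ _ M) => //.
- split=> //; rewrite ?subnn //= ?upd_same //.
  by apply: fr_setr => //; rewrite inE eqxx.
- move=> k s' [kM hf hi hJ]; split.
    rewrite /= (eval_indep iN hf) -/M hi; lia.
  have kM' : M - k.+1 < M by lia.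
  rewrite /=; apply: wp_use (hS _ _ kM' hf hi hJ) _ => s2 f2.
  have e2 : s2.1 i = M - k.+1 by case: f2 => /(_ i ic) ->.
  have -> : (M - k.+1).+1 = M - k by lia.
  move=> hJ2; rewrite /= e2.
  have -> : M - k.+1 + 1 = M - k by lia.
  split=> //; first by lia.
  apply: fr_setr; last by rewrite inE eqxx.
  apply: fr_trans hf _; apply: fr_sub f2 _ _ => // x xW.
  by rewrite inE xW orbT.
  by rewrite /= upd_same.
- move=> s' [_ hf hi hJ]; split; last by apply: hQ => //; rewrite -[M]subn0.
  by rewrite /= (eval_indep iN hf) -/M hi subn0 subnn.
Qed.

Local Notation rmx := 6%N (only parsing).
Local Notation rmy := 7%N (only parsing).
Local Notation rmp := 8%N (only parsing).
Local Notation rmk := 9%N (only parsing).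
Local Notation rma := 10%N (only parsing).
Local Notation apw := 6%N (only parsing).
Local Notation amx := 7%N (only parsing).

(* Binary multiplication: the doubled arguments are tabulated, then the
   multiplier is expanded greedily from its leading power of two. *)
Definition CMul (r : nat) (a b : expr) : com :=
  rma ::= a ;; rmy ::= b ;; rmx ::= EV rma ;; rmk ::= EC 0 ;; rmp ::= EC 1 ;;
  CWhile (EV rmy :+ EC 1 :- EV rmp)
    (CSto apw (EV rmk) (EV rmp) ;; CSto amx (EV rmk) (EV rmx) ;;
     rmp ::= EV rmp :+ EV rmp ;; rmx ::= EV rmx :+ EV rmx ;;
     rmk ::= EV rmk :+ EC 1) ;;
  rma ::= EC 0 ;;
  CWhile (EV rmk)
    (rmk ::= EV rmk :- EC 1 ;;
     CIf (ELd apw (EV rmk) :- EV rmy)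
       (rmp ::= EC 0)
       (rmy ::= EV rmy :- ELd apw (EV rmk) ;; rma ::= EV rma :+ ELd amx (EV rmk))) ;;
  r ::= EV rma.

(** Only the second factor is bounded, since the loops run once per binary digit of it. It is
    evaluated after [rma] has received [a], whence the independence condition. *)
Lemma wp_mul Y r a b Q s :
  indep b [:: rma] [::] -> eval b s < 2 ^ Y ->
  (forall s', fr [:: rma; rmy; rmx; rmk; rmp; r] [:: apw; amx] s s' ->
     s'.1 r = eval a s * eval b s -> Q s') ->
  wp Y (CMul r a b) Q s.
Proof.
move=> ib bY hQ.
have : wp Y (CMul r a b) (fun s' => s'.1 r = eval a s * eval b s) s; last first.
  move=> h; apply: wp_use h _ => s' f; apply: hQ.
  apply: fr_sub f _ _ => x; rewrite /= !inE.
    by do ![case/orP=> [/eqP -> |]; rewrite ?eqxx ?orbT //]; move/eqP ->; rewrite eqxx ?orbT.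
  by do ![case/orP=> [/eqP -> |]; rewrite ?eqxx ?orbT //]; move/eqP ->; rewrite eqxx ?orbT.
set x := eval a s; set y := eval b s in bY *.
have ey : eval b (setr s rma x) = y by apply: (eval_indep ib); apply: fr_setr.
rewrite /CMul; do 5 (wseq; wasg); wseq.
set s1 := setr _ rmp _.
(* The number of powers of two that are at most [y]; zero is separate because [trunc_log 2 0] is
   0. *)
pose N := if y == 0 then 0 else (trunc_log 2 y).+1.
have N2 : y < 2 ^ N by rewrite /N; case: eqP => [->//|_]; apply: trunc_log_ltn.
have Nle k : 2 ^ k <= y -> k < N.
  move=> h; rewrite ltnNge; apply/negP => Nk.
  have : 2 ^ N <= 2 ^ k by rewrite leq_exp2l.
  lia.
have Nge k : k < N -> 2 ^ k <= y.
  rewrite /N; case: posnP => // y0; rewrite ltnS => kl.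
  by apply: leq_trans (trunc_logP (isT : 1 < 2) y0); rewrite leq_exp2l.
have NY : N <= Y.
  rewrite leqNgt; apply/negP => /Nge; lia.
pose I1 n s' := n <= N /\ [/\ s'.1 rmk = N - n, s'.1 rmp = 2 ^ (N - n), s'.1 rmy = y,
   s'.1 rmx = x * 2 ^ (N - n) &
   forall k, k < N - n -> s'.2 apw k = 2 ^ k /\ s'.2 amx k = x * 2 ^ k].
(* With the remaining multiplier below [2 ^ n], subtracting the next lower power at most once clears
   its leading digit. *)
pose I2 n s' := n <= N /\ [/\ s'.1 rmk = n, s'.1 rmy < 2 ^ n,
   s'.1 rma + x * s'.1 rmy = x * y &
   forall k, k < N -> s'.2 apw k = 2 ^ k /\ s'.2 amx k = x * 2 ^ k].
apply: (@wp_while _ _ _ I1 _ _ N) => //.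
- split=> //; rewrite subnn expn0 muln1.
  by rewrite /s1 /= -/x ey /upd /=; split.
- move=> k s' [kN [e1 e2 e3 e4 ea]].
  have lt : N - k.+1 < N by lia.
  have := Nge _ lt => le1.
  have eN : N - k = (N - k.+1).+1 by lia.
  have sN : 2 ^ (N - k) = 2 ^ (N - k.+1) + 2 ^ (N - k.+1) by rewrite eN expnS; lia.
  split; first by rewrite /= e2 e3; lia.
  split; first by lia.
  rewrite /= /upd /= e1 e2 e3 e4; split=> //=; try lia; rewrite ?sN; try lia.
  move=> i; rewrite eN ltnS leq_eqVlt => /orP [/eqP ->|il].
    by rewrite eqxx.
  by rewrite (ltn_eqF il); apply: ea.
- move=> s' [_ [e1 e2 e3 e4 ea]]; rewrite subn0 in e1 e2 e4 ea; split.
    by rewrite /= e2 e3; lia.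
  wseq; wasg; wseq; apply: (@wp_while _ _ _ I2 _ _ N) => //.
  + split=> //; split; rewrite /= /upd /= ?e1 ?e3 //; lia.
  + move=> k s2 [kN [f1 f2 f3 fa]]; split; first by rewrite /= f1.
    have [pk xk] := fa k kN.
    wseq; wasg; apply: wp_if; rewrite /= /upd /= f1 subn1 /= pk => hle.
      by split; [lia | rewrite /= /upd /= ?f1 ?subn1; split=> //=; lia].
    split; first by lia.
    rewrite /= /upd /= ?f1 ?subn1 /= ?pk ?xk; split=> //; move: f2; rewrite expnS; nia.
  + by move=> s2 [_ [f1 f2 f3 fa]]; split; rewrite //= /upd /= eqxx; move: f2; rewrite expn0; nia.
Qed.


Arguments wp : simpl never.

(** * Ordering the path, prefix sums and types *)

Ltac frw h :=
  let W := type of h in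
  match W with fr _ _ _ ?s' =>
    rewrite /= /upd /=;
    repeat match goal with
    | |- context [fst s' ?r] => rewrite (proj1 h r isT)
    | |- context [snd s' ?j] => rewrite (proj2 h j isT)
    end;
    rewrite /= /upd /=
  end.

Definition Cneq a b := (a :- b) :+ (b :- a).

Lemma wp_ifneq Y a b c1 c2 Q s :
  (eval a s <> eval b s -> wp Y c1 Q s) -> (eval a s = eval b s -> wp Y c2 Q s) ->
  wp Y (CIf (Cneq a b) c1 c2) Q s.
Proof. by move=> h1 h2; apply: wp_if => /= h; [apply: h1 | apply: h2]; lia. Qed.

Lemma wp_ifgt Y a b c1 c2 Q s :
  (eval b s < eval a s -> wp Y c1 Q s) -> (eval a s <= eval b s -> wp Y c2 Q s) ->
  wp Y (CIf (a :- b) c1 c2) Q s.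
Proof. by move=> h1 h2; apply: wp_if => /= h; [apply: h1 | apply: h2]; lia. Qed.

(* Variables: 0 input length L, 1 answer, 2 m, 3 n, 4 m + 1, 5 offset of the
   utilities in the input, 6 to 10 multiplication, 19 L^d, 20 target code, 21 guess.
   Arrays: 0 input, 1 order of the items on the path, 2 weights L^(type i),
   3 prefix sums, 4 thresholds, 5 reachability table, 6 and 7 multiplication. *)
Definition init_prog : com :=
  CSto 0 (EC 3) (EC 0) ;; 2 ::= ELd 0 (EC 1) ;; 3 ::= ELd 0 (EC 2) ;;
  4 ::= EV 2 :+ EC 1 ;; CMul 5 (EV 2) (EV 2) ;; 5 ::= EV 5 :+ EC 3.

Definition endpoint_prog : com :=
  CFor 11 (EV 2)
    (14 ::= EC 0 ;; CMul 13 (EV 11) (EV 2) ;;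
     CFor 12 (EV 2) (14 ::= EV 14 :+ ELd 0 (EC 3 :+ EV 13 :+ EV 12)) ;;
     CIf (EV 14 :- EC 1) (14 ::= EC 0) (15 ::= EV 11)).

Definition walk_prog : com :=
  16 ::= EV 15 ;;
  CFor 18 (EV 2)
    (CSto 1 (EV 18) (EV 15) ;; 17 ::= EV 15 ;; CMul 13 (EV 15) (EV 2) ;;
     CFor 12 (EV 2)
       (CIf (ELd 0 (EC 3 :+ EV 13 :+ EV 12))
         (CIf (Cneq (EV 12) (EV 16)) (17 ::= EV 12) (17 ::= EV 17))
         (17 ::= EV 17)) ;;
     16 ::= EV 15 ;; 15 ::= EV 17).

Definition prefix_prog : com :=
  CFor 11 (EV 3)
    (CMul 13 (EV 11) (EV 2) ;; 13 ::= EV 5 :+ EV 13 :+ EV 13 ;;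
     CMul 14 (EV 11) (EV 4) ;; CSto 3 (EV 14) (EC 0) ;;
     CFor 18 (EV 2)
       (16 ::= ELd 1 (EV 18) ;; 15 ::= ELd 0 (EV 13 :+ EV 16 :+ EV 16) ;;
        CFor 12 (EV 2)
          (CIf (Cneq (EV 12) (EV 16))
            (CMul 15 (EV 15) (ELd 0 (EV 13 :+ EV 12 :+ EV 12 :+ EC 1)))
            (17 ::= EC 0)) ;;
        CSto 3 (EV 14 :+ EV 18 :+ EC 1) (ELd 3 (EV 14 :+ EV 18) :+ EV 15))).

Definition types_prog : com :=
  19 ::= EC 1 ;;
  CFor 11 (EV 3)
    (16 ::= EC 0 ;; CMul 13 (EV 11) (EV 2) ;; 13 ::= EV 5 :+ EV 13 :+ EV 13 ;;
     CFor 12 (EV 11)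
       (CMul 14 (EV 12) (EV 2) ;; 14 ::= EV 5 :+ EV 14 :+ EV 14 ;; 15 ::= EC 0 ;;
        CFor 18 (EV 2 :+ EV 2)
          (CIf (Cneq (ELd 0 (EV 13 :+ EV 18)) (ELd 0 (EV 14 :+ EV 18)))
            (15 ::= EC 1) (17 ::= EC 0)) ;;
        CIf (EV 15) (17 ::= EC 0) (16 ::= EC 1 ;; CSto 2 (EV 11) (ELd 2 (EV 12)))) ;;
     CIf (EV 16) (17 ::= EC 0) (CSto 2 (EV 11) (EV 19) ;; CMul 19 (EV 19) (EV 0))).

Definition target_prog : com :=
  20 ::= EC 0 ;; CFor 11 (EV 3) (20 ::= EV 20 :+ ELd 2 (EV 11) :+ EV 19).

Lemma row_neq m i k q q' : i < k -> q <= m -> i * m.+1 + q != k * m.+1 + q'.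
Proof.
move=> ik qm; have : i.+1 * m.+1 <= k * m.+1 by rewrite leq_mul2r ik orbT.
by move=> h; apply/eqP; lia.
Qed.

Section Phases.
Variables (Y L m n : nat) (inp : nat -> nat).
Hypotheses (mY : m + m < Y) (nY : n < Y) (LY : L < Y).

Definition base (s : store) : Prop :=
  [/\ s.1 0 = L, s.1 2 = m, s.1 3 = n, s.1 4 = m.+1 & s.1 5 = m * m + 3 /\ s.2 0 = inp].

Lemma base_fr W A s s' : fr W A s s' -> base s ->
  (all (fun r => r \notin W) [:: 0; 2; 3; 4; 5]) && (0 \notin A) -> base s'.
Proof.
move=> [h1 h2] [b0 b2 b3 b4 [b5 bi]] /andP[/= /and5P[n0 n2 n3 n4 /andP[n5 _]] nA].
by rewrite /base !h1 ?h2.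
Qed.

Lemma base_setr s r v : base s -> r \notin [:: 0; 2; 3; 4; 5] -> base (setr s r v).
Proof.
move=> bs hr; apply: base_fr (fr_setr v (fr_refl [:: r] [::] s) _) bs _.
  by rewrite inE.
by move: hr; rewrite /= !inE !(eq_sym r) !negb_or => /and5P[-> -> -> -> ->].
Qed.

Let mY1 : m < Y.
Proof. by lia. Qed.

Lemma ltn2Y x : x < Y -> x < 2 ^ Y.
Proof. by move=> xY; apply: ltn_trans xY (ltn_expl _ _). Qed.

Definition adjn x y := inp (3 + x * m + y).

Definition degn x := \sum_(0 <= y < m) adjn x y.

Lemma endpoint_correct s : base s -> (exists2 x, x < m & degn x <= 1) ->
  wp Y endpoint_prog (fun s' => s'.1 15 < m /\ degn (s'.1 15) <= 1) s.
Proof.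
move=> bs [x0 x0m hx0].
(* An implication, because variable 15 is meaningless until some endpoint has been met; later
   endpoints overwrite earlier ones. *)
pose J k (s' : store) := (exists2 x, x < k & degn x <= 1) ->
  s'.1 15 < m /\ degn (s'.1 15) <= 1.
have [e0 e2 e3 e4 [e5 ei]] := bs.
apply: (@wp_for J) => //=.
- by rewrite e2 ltnW.
- by case.
- rewrite e2 => k s' km f ik hJ; have bs' := base_fr f bs isT.
  have [g0 g2 g3 g4 [g5 gi]] := bs'.
  wseq; wasg; wseq; apply: wp_mul => //=; first by rewrite upd_other // g2 ltn2Y.
  move=> s2 f2; rewrite /= /upd /= ik g2 => h13; wseq.
  apply: (@wp_for (fun k' s' => s'.1 14 = \sum_(0 <= y < k') adjn k y)) => //=.
  + by frw f2; rewrite /= /upd /= g2 ltnW.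
  + by rewrite big_nil; frw f2.
  + frw f2; rewrite /= /upd /= g2 => k' s3 k'm f3 ik' h14.
    by wasg; frw f3; frw f2; rewrite big_nat_recr //= h14 ik' h13 gi.
  frw f2; rewrite /= /upd /= g2 => s3 f3 h14.
  apply: wp_if => /=; rewrite h14 -/(degn k) => hd.
    wasg; rewrite /J /= /upd /= => -[x]; frw f3; frw f2; rewrite /= /upd /=.
    rewrite ltnS leq_eqVlt => /orP[/eqP ->|xk] hx; first by lia.
    by apply: hJ; exists x.
  wasg; rewrite /J /= /upd /= => _; frw f3; frw f2; rewrite /= /upd /= ik; split=> //; lia.
- by move=> s' f; rewrite e2; apply; exists x0.
Qed.

(** Here [p] is the position on the path. The successor of an item is its only neighbour other than
    the item visited just before. *)
Lemma walk_correct (p : nat -> nat) s : base s ->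
  (forall x, x < m -> p x < m) ->
  (forall x y, x < m -> y < m -> p x = p y -> x = y) ->
  (forall k, k < m -> exists2 x, x < m & p x = k) ->
  (forall x y, x < m -> y < m ->
     adjn x y = (((p x).+1 == p y) || ((p y).+1 == p x))) ->
  s.1 15 < m -> p (s.1 15) = 0 ->
  wp Y walk_prog (fun s' => forall k, k < m -> s'.2 1 k < m /\ p (s'.2 1 k) = k) s.
Proof.
move=> bs plt pinj psurj padj cm c0.
(* At the start the previous item is the endpoint itself, which agrees with [k.-1] for [k = 0].
   After the last item nothing is claimed about the current one. *)
pose J k (s' : store) :=
  [/\ forall k', k' < k -> s'.2 1 k' < m /\ p (s'.2 1 k') = k',
      k < m -> s'.1 15 < m /\ p (s'.1 15) = k &
      s'.1 16 < m /\ p (s'.1 16) = k.-1].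
have [e0 e2 e3 e4 [e5 ei]] := bs.
wseq; wasg; apply: (@wp_for J) => //=.
- by rewrite /= /upd /= e2 ltnW.
rewrite /= /upd /= e2 => k s' km f ik [h1 /(_ km) [h2 h2'] [h3 h3']].
have bs' := base_fr f (@base_setr _ 16 (s.1 15) bs isT) isT.
have [g0 g2 g3 g4 [g5 gi]] := bs'.
wseq; wsto; wseq; wasg; wseq; apply: wp_mul => //=.
  by rewrite /= /upd /= g2 ltn2Y.
rewrite /= /upd /= g2 => s2 f2 h13; wseq.
set cur := s'.1 15 in h2 h2' f2 h13; set prev := s'.1 16 in h3 h3'.
pose J2 k' (s' : store) := s'.1 17 < m /\
  ((p (s'.1 17) = k.+1) \/ (s'.1 17 = cur /\ forall y, y < k' -> p y <> k.+1)).
apply: (@wp_for J2) => //=.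
- by frw f2; rewrite /= /upd /= g2 ltnW.
- by rewrite /J2 /= /upd /=; frw f2; rewrite /= /upd /=; split=> //; right.
- frw f2; rewrite /= /upd /= g2 => k' s3 k'm f3 ik' [h17 hp].
  apply: wp_if; rewrite /= ik'; frw f3; rewrite h13; frw f2; rewrite /= /upd /= gi.
    rewrite -/(adjn cur k') padj // h2' => hadj.
    apply: wp_ifneq => /=; rewrite ik'; frw f3; frw f2; rewrite -/prev => hneq;
      wasg; rewrite /J2 /= /upd /= ?ik'; split=> //.
      left; move: hadj; case: eqP => // _; case: eqP => // pk' _.
      by case: hneq; apply: pinj => //; rewrite h3' -pk'.
    case: hp => [|[hc hp]]; [by left|right].
    split=> // y; rewrite ltnS leq_eqVlt => /orP[/eqP ->|]; last exact: hp.
    by rewrite hneq h3'; lia.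
  rewrite -/(adjn cur k') padj // h2' => hadj.
  wasg; rewrite /J2 /= /upd /=; split=> //; case: hp => [|[hc hp]]; [by left|right].
  split=> // y; rewrite ltnS leq_eqVlt => /orP[/eqP ->|]; last exact: hp.
  by move: hadj; case: eqP => // ne _ /esym.
frw f2; rewrite /= /upd /= g2 => s3 f3 [h17 hp].
wseq; wasg; wasg; rewrite /J /= /upd /=; frw f3; frw f2; rewrite /= /upd /=; split=> //.
- move=> k'; rewrite ltnS leq_eqVlt ik => /orP[/eqP ->|k'k]; first by rewrite eqxx.
  by rewrite (ltn_eqF k'k); apply: h1.
- move=> k1m; split=> //; case: hp => // -[_ hp].
  by have [x xm px] := psurj _ k1m; case: (hp x xm).
by move=> s' _; rewrite /= /upd /= e2 => -[].
Qed.


(** The input occupies array 0 from index 1, so [m], [n] and the adjacency matrix end at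
    [m * m + 2]. Each utility takes two cells. *)
Definition rown i := m * m + 3 + i * m + i * m.
Definition numn i v := inp (rown i + v + v).
Definition denn i v := inp (rown i + v + v + 1).
(** The utility of [v] times all denominators of player [i]: the denominator of [v] itself
    cancels. *)
Definition wn i v := numn i v * \prod_(0 <= v' < m | v' != v) denn i v'.
Definition Sn (ord : nat -> nat) i k := \sum_(0 <= k' < k) wn i (ord k').

Lemma prefix_correct s : base s ->
  (forall i v, i < n -> v < m -> denn i v < 2 ^ Y) ->
  wp Y prefix_prog (fun s' => forall i q, i < n -> q <= m ->
    s'.2 3 (i * m.+1 + q) = Sn (s.2 1) i q) s.
Proof.
move=> bs dY; have [e0 e2 e3 e4 [e5 ei]] := bs.
apply: (@wp_for (fun k s' => forall i q, i < k -> q <= m ->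
    s'.2 3 (i * m.+1 + q) = Sn (s.2 1) i q)) => //=; rewrite e3 //.
  by rewrite ltnW.
move=> k s' kn f ik hJ; have bs' := base_fr f bs isT.
have [g0 g2 g3 g4 [g5 gi]] := bs'.
wseq; apply: wp_mul => //=; first by rewrite g2 ltn2Y.
rewrite ik g2 => s1 f1 h13; wseq; wasg; wseq; apply: wp_mul => //=.
  by frw f1; rewrite g4 ltn2Y //; lia.
frw f1; rewrite h13 ik g4 g5 => s2 f2 h14; wseq; wsto.
pose J2 k' (s4 : store) :=
  (forall i q, i < k -> q <= m -> s4.2 3 (i * m.+1 + q) = Sn (s.2 1) i q) /\
  (forall q, q <= k' -> s4.2 3 (k * m.+1 + q) = Sn (s.2 1) k q).
have h13' : s2.1 13 = rown k by frw f2; rewrite /rown; lia.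
have b2 : base s2.
  by apply: base_fr f2 _ isT; apply: base_setr => //; apply: base_fr f1 bs' isT.
have [b20 b22 b23 b24 [b25 b2i]] := b2.
apply: (@wp_for J2) => //=.
- by rewrite b22 ltnW.
- split=> [i q ik' qm|q]; rewrite /= /upd /= h14.
    by rewrite -[k * m.+1]addn0 (negbTE (row_neq _ ik' qm)); frw f2; frw f1; apply: hJ.
  by rewrite leqn0 => /eqP ->; rewrite addn0 eqxx /Sn big_nil.
- rewrite b22 => k' s4 k'm f4 ik' [j1 j2].
  have ev1 : s4.2 1 = s.2 1 by frw f4; frw f2; frw f1; frw f.
  wseq; wasg; wseq; wasg; wseq.
  have g13 : s4.1 13 = rown k by frw f4.
  have g0i : s4.2 0 = inp by frw f4.
  have g2m : s4.1 2 = m by frw f4.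
  set v := s.2 1 k'.
  apply: (@wp_for (fun k2 s5 => s5.1 15 =
     numn k v * \prod_(0 <= v' < k2 | v' != v) denn k v')) => //=; rewrite /= /upd /=.
  + by rewrite g2m ltnW.
  + by rewrite big_nil muln1 g13 g0i ik' ev1.
  + rewrite g2m => k2 s5 k2m f5 ik2 h15.
    have w16 : s5.1 16 = v by frw f5; rewrite ik' ev1.
    have w13 : s5.1 13 = rown k by frw f5.
    have w0 : s5.2 0 = inp by frw f5.
    apply: wp_ifneq => /=; rewrite w16 ik2 => hv.
      (* The denominator is the second factor because it is the one known to be below [2 ^ Y]; no
         bound on the accumulated product is tracked. *)
      apply: wp_mul => //=; rewrite w0 w13 ik2 -/(denn k k2); first exact: dY.
      rewrite h15 => s6 f6 h15'; rewrite /= /upd /= h15' [in RHS]big_mkcond big_nat_recr //=.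
      by rewrite -big_mkcond /= (introN eqP hv) mulnA.
    wasg; rewrite /= /upd /= h15; congr (_ * _).
    by rewrite big_mkcond [RHS]big_mkcond big_nat_recr //= hv eqxx muln1.
  + rewrite g2m => s5 f5 h15; wsto.
    rewrite /J2 /= /upd /=; frw f5.
    have -> : s4.1 14 = k * m.+1 by frw f4.
    rewrite ik' h15; split=> [i q ik2 qm|q].
      by rewrite -addnA (negbTE (row_neq _ ik2 qm)); apply: j1.
    rewrite leq_eqVlt => /orP[/eqP ->|qk].
      by rewrite -addnA addn1 eqxx j2 // /Sn big_nat_recr.
    by rewrite -addnA eqn_add2l addn1 (ltn_eqF qk); apply: j2.
rewrite b22 => s4 f4 [j1 j2] i q; rewrite ltnS leq_eqVlt => /orP[/eqP ->|ik'] qm.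
  exact: j2.
exact: j1.
Qed.

Definition samen i j := forall v, v < m + m -> inp (rown i + v) = inp (rown j + v).

(** That every number below [d] is attained is what later bounds [d] by [num_types]. *)
Definition typing (k : nat) (W : nat -> nat) (pw : nat) (t : nat -> nat) (d : nat) :=
  [/\ pw = L ^ d, forall i, i < k -> W i = L ^ t i /\ t i < d,
      forall i j, i < k -> j < k -> (t i = t j <-> samen i j) &
      forall c, c < d -> exists2 i, i < k & t i = c].

Lemma types_correct s : base s ->
  wp Y types_prog (fun s' => exists t d, typing n (s'.2 2) (s'.1 19) t d) s.
Proof.
move=> bs; wseq; wasg; have {}bs := @base_setr _ 19 1 bs isT.
have [e0 e2 e3 e4 [e5 ei]] := bs.
apply: (@wp_for (fun k s' => exists t d, typing k (s'.2 2) (s'.1 19) t d)) => //.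
- by rewrite [eval _ _]e3 ltnW.
- by exists id, 0; split.
- rewrite [eval _ _]e3 => k s1 kn f1 ik [t [d [hpw hW ht hd]]].
  have b1 := base_fr f1 bs isT; have [g0 g2 g3 g4 [g5 gi]] := b1.
  wseq; wasg; wseq; apply: wp_mul => //=; first by rewrite /= /upd /= g2 ltn2Y.
  rewrite /= /upd /= ik g2 => s2 f2 h13; wseq; wasg; wseq.
  pose J2 k' (s4 : store) := (forall i, i < k -> s4.2 2 i = s1.2 2 i) /\
    if s4.1 16 == 0 then forall i', i' < k' -> ~ samen k i'
    else exists i', [/\ i' < k', samen k i' & s4.2 2 k = s1.2 2 i'].
  have e13 : s2.1 5 + s2.1 13 + s2.1 13 = rown k.
    by rewrite h13; frw f2; rewrite g5 /rown.
  apply: (@wp_for J2) => //=.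
  + by frw f2; rewrite ik; lia.
  + by split=> /=; rewrite /= /upd /=; frw f2.
  + rewrite /= /upd /= e13; frw f2; rewrite ik => k' s3 k'k f3 ik' [j1 j2].
    have b3 : base s3.
      apply: base_fr f3 _ isT; apply: base_setr => //; apply: base_fr f2 _ isT.
      exact: base_setr.
    have [c0 c2 c3 c4 [c5 ci]] := b3.
    wseq; apply: wp_mul => //=; first by rewrite c2 ltn2Y.
    rewrite ik' c2 => s4 f4 h14; wseq; wasg; wseq; wasg; wseq.
    have e14 : s4.1 5 + s4.1 14 + s4.1 14 = rown k'.
      by rewrite h14; frw f4; rewrite c5 /rown.
    apply: (@wp_for (fun k2 s5 => if s5.1 15 == 0 then
        forall v, v < k2 -> inp (rown k + v) = inp (rown k' + v)
        else ~ samen k k')) => //=; rewrite /= /upd /=.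
    * by frw f4; rewrite c2; lia.
    * rewrite e14; frw f4; rewrite c2 => k2 s5 k2m f5 ik2 h15.
      apply: wp_ifneq => /=; rewrite ik2; frw f5; frw f4; rewrite ci; frw f3 => heq;
        wasg; rewrite /= /upd /=.
        by move=> hs; apply: heq; apply: hs.
      case: eqP h15 => // _ hv v; rewrite ltnS leq_eqVlt => /orP[/eqP ->//|].
      exact: hv.
    * rewrite e14; frw f4; rewrite c2 => s5 f5 h15.
      have f5' : forall i, s5.2 2 i = s3.2 2 i by move=> i; frw f5; frw f4.
      have f16 : s5.1 16 = s3.1 16 by frw f5; frw f4.
      have f11 : s5.1 11 = k by frw f5; frw f4; frw f3; frw f2.
      have f12 : s5.1 12 = k' by frw f5; frw f4.
      apply: wp_if => /= /eqP z15; move: h15; rewrite ?(negbTE z15) ?z15 => hs.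
        wasg; split=> /=; first by move=> i ik2; rewrite f5' j1.
        rewrite /= /upd /= f16; case: eqP j2 => _ j2.
          move=> i'; rewrite ltnS leq_eqVlt => /orP[/eqP ->//|]; exact: j2.
        by case: j2 => i' [h1 h2 h3]; exists i'; split=> //; [lia | rewrite f5'].
      wseq; wasg; wsto; split=> /=; rewrite /= /upd /= f11.
        by move=> i ik2; rewrite (ltn_eqF ik2) f5' j1.
      by exists k'; split=> //; rewrite eqxx f12 f5' j1.
  + rewrite /= /upd /= e13; frw f2; rewrite ik => s3 f3 [j1 j2].
    have f19 : s3.1 19 = s1.1 19 by frw f3; frw f2.
    have f11 : s3.1 11 = k by frw f3; frw f2.
    have f00 : s3.1 0 = L by frw f3; frw f2.
    apply: wp_if => /= z16; move: j2.
      rewrite (introF eqP z16) => -[i' [i'k hs hWk]].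
      wasg; rewrite /= /upd /= f19; exists (fun i => if i == k then t i' else t i), d.
      have [Wi' ti'] := hW i' i'k; split=> //.
      * move=> i; rewrite ltnS leq_eqVlt => /orP[/eqP ->|ik2].
          by rewrite eqxx hWk.
        by rewrite (ltn_eqF ik2) j1 //; apply: hW.
      * have symm i j : samen i j -> samen j i by move=> h v hv; rewrite h.
        have tr i j l : samen i j -> samen j l -> samen i l.
          by move=> h h' v hv; rewrite h // h'.
        move=> i j; rewrite !ltnS (leq_eqVlt i) (leq_eqVlt j).
        case/orP=> [/eqP -> | ik2]; case/orP=> [/eqP -> | jk2]; rewrite ?eqxx
          ?(ltn_eqF ik2) ?(ltn_eqF jk2) //.
        - by rewrite ht //; split; apply: tr => //; apply: symm.
        - by rewrite ht //; split=> h; apply: tr h _ => //; apply: symm.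
        - exact: ht.
      * move=> c /hd [i ik2 <-]; exists i; first by lia.
        by rewrite (ltn_eqF ik2).
    rewrite z16 eqxx => hn.
    wseq; wsto; apply: wp_mul => //=; first by rewrite f00 ltn2Y.
    move=> s4 f4; rewrite f19 f00 hpw => h19.
    exists (fun i => if i == k then d else t i), d.+1; split=> /=; rewrite /= /upd /=.
    * by rewrite h19 expnSr.
    * frw f4; rewrite f11 f19 => i; rewrite ltnS leq_eqVlt => /orP[/eqP ->|ik2].
        by rewrite eqxx hpw.
      by rewrite (ltn_eqF ik2) j1 //; have [-> ] := hW i ik2; split=> //; lia.
    * move=> i j; rewrite !ltnS (leq_eqVlt i) (leq_eqVlt j).
      case/orP=> [/eqP -> | ik2]; case/orP=> [/eqP -> | jk2]; rewrite ?eqxx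
          ?(ltn_eqF ik2) ?(ltn_eqF jk2) //.
      - split=> [h|]; last by move/(hn _ jk2).
        by have [_] := hW j jk2; lia.
      - split=> [h|h]; first by have [_] := hW i ik2; lia.
        by case: (hn _ ik2) => v hv; rewrite h.
      - exact: ht.
    * move=> c; rewrite ltnS leq_eqVlt => /orP[/eqP ->|/hd [i ik2 <-]].
        by exists k; rewrite ?eqxx.
      by exists i; [lia | rewrite (ltn_eqF ik2)].
- by move=> s1 f1; rewrite [eval (EV 3) _]e3.
Qed.

Lemma target_correct s : base s ->
  wp Y target_prog (fun s' =>
    s'.1 20 = \sum_(0 <= i < n) (s.2 2 i + s.1 19)) s.
Proof.
move=> bs; have [e0 e2 e3 e4 [e5 ei]] := bs; wseq; wasg.
apply: (@wp_for (fun k s' => s'.1 20 = \sum_(0 <= i < k) (s.2 2 i + s.1 19))) => //=;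
  rewrite /= /upd /= ?e3 ?big_nil //; first by rewrite ltnW.
move=> k s1 kn f1 ik h; wasg.
by rewrite /= /upd /= h big_nat_recr //= ik; frw f1; rewrite addnA.
Qed.

End Phases.

(** * Guessing thresholds and tabulating reachable states *)

Definition CDiv (rq rr : nat) (d : expr) : com :=
  rq ::= EC 0 ;;
  CWhile (EV rr :+ EC 1 :- d) (rr ::= EV rr :- d ;; rq ::= EV rq :+ EC 1).

(** Division by repeated subtraction iterates as often as the quotient says, which is affordable for
    dividends up to [Y]. *)
Lemma wp_div Y rq rr d Q s :
  rq != rr -> indep d [:: rq; rr] [::] -> 0 < eval d s -> s.1 rr <= Y ->
  (forall s', fr [:: rq; rr] [::] s s' -> s'.1 rq = s.1 rr %/ eval d s ->
     s'.1 rr = s.1 rr %% eval d s -> Q s') ->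
  wp Y (CDiv rq rr d) Q s.
Proof.
move=> qr id d0 xY hQ; set x := s.1 rr in xY hQ *; set D := eval d s in d0 hQ *.
have rq' : rr != rq by rewrite eq_sym.
wseq; wasg.
pose I k (s' : store) := [/\ fr [:: rq; rr] [::] s s', k <= x %/ D,
  s'.1 rq = x %/ D - k & s'.1 rr = k * D + x %% D].
have xm : x %% D < D by rewrite ltn_mod.
apply: (@wp_while _ _ _ I _ _ (x %/ D)).
- by apply: leq_trans xY; apply: leq_div.
- split=> //=; first by apply: fr_setr; rewrite ?inE ?eqxx.
    by rewrite upd_same subnn.
  by rewrite upd_other // -/x -divn_eq.
- move=> k s' [f kx eq er]; have ed := eval_indep id f.
  split; first by rewrite /= ed er -/D; lia.
  wseq; wasg; wasg; rewrite /=; split=> //=.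
  + by do 2 (apply: fr_setr; last by rewrite !inE ?eqxx ?orbT).
  + by lia.
  + by rewrite upd_same upd_other // eq; lia.
  + rewrite upd_other // upd_same ed er -/D; lia.
- move=> s' [f _ eq er]; have ed := eval_indep id f; rewrite subn0 in eq.
  split; first by rewrite /= ed er -/D; lia.
  exact: hQ.
Qed.

Definition threshold_prog : com :=
  CFor 11 (EV 3)
    (13 ::= EV 21 ;; CDiv 12 13 (ELd 2 (EV 11)) ;; CDiv 14 12 (EV 0) ;;
     CDiv 14 12 (EV 4) ;; CDiv 16 14 (EV 4) ;; CMul 15 (EV 11) (EV 4) ;;
     CSto 4 (EV 11) (ELd 3 (EV 15 :+ EV 12) :- ELd 3 (EV 15 :+ EV 14))).

Definition transition_prog : com :=
  28 ::= EC 0 ;;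
  CFor 29 (EV 3)
    (CMul 30 (EV 29) (EV 4) ;;
     CIf (ELd 3 (EV 30 :+ EV 23) :- ELd 3 (EV 30 :+ EV 25) :- ELd 4 (EV 29))
       (28 ::= EC 1) (31 ::= EC 0)) ;;
  CMul 30 (EV 26) (EV 4) ;;
  CIf (ELd 4 (EV 26) :- (ELd 3 (EV 30 :+ EV 23) :- ELd 3 (EV 30 :+ EV 25)))
    (28 ::= EC 1) (31 ::= EC 0) ;;
  CIf (EV 28) (31 ::= EC 0) (24 ::= EC 1).

Definition entry_prog : com :=
  24 ::= EC 1 :- (EV 22 :+ EV 23) ;;
  CFor 25 (EV 23 :+ EC 1)
    (CFor 26 (EV 3)
      (27 ::= ELd 2 (EV 26) :+ EV 19 ;;
       CIf (EV 27 :- EV 22) (28 ::= EC 0)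
         (CMul 27 (EV 22 :- EV 27) (EV 4) ;;
          CIf (ELd 5 (EV 27 :+ EV 25)) transition_prog (28 ::= EC 0)))).

Definition table_prog : com :=
  CFor 22 (EV 20 :+ EC 1)
    (CFor 23 (EV 4)
      (entry_prog ;; CMul 27 (EV 22) (EV 4) ;; CSto 5 (EV 27 :+ EV 23) (EV 24))).

Definition search_prog : com :=
  1 ::= EC 0 ;;
  CFor 21 (EV 19)
    (threshold_prog ;; table_prog ;; CMul 27 (EV 20) (EV 4) ;;
     CIf (ELd 5 (EV 27 :+ EV 2)) (1 ::= EC 1) (31 ::= EC 0)).

Section Reach.
Variables (m n pw : nat) (W S : nat -> nat).

Definition segval j a q := S (j * m.+1 + q) - S (j * m.+1 + a).

Definition fits (Af : nat -> nat) a q i :=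
  (forall j, j < n -> segval j a q <= Af j) /\ Af i <= segval i a q.

(** Owners are listed from the last segment backwards. Empty segments are allowed, and so are
    repetitions of a player. *)
Inductive steps (Af : nat -> nat) : nat -> seq nat -> Prop :=
| steps_nil : steps Af 0 [::]
| steps_cons a q i l : steps Af a l -> a <= q -> i < n -> fits Af a q i ->
    steps Af q (i :: l).

(* The summand pw of every step counts the players, so that a code with the right
   sum cannot come from a list of another length. *)
Definition code (l : seq nat) := \sum_(i <- l) (W i + pw).

Definition reach Af c q := exists2 l, steps Af q l & code l = c.

Definition arrives Af c q a i :=
  [/\ W i + pw <= c, reach Af (c - (W i + pw)) a & fits Af a q i].

Lemma reachE Af c q : 0 < pw ->
  reach Af c q <-> (c = 0 /\ q = 0) \/
    exists2 a, a < q.+1 & exists2 i, i < n & arrives Af c q a i.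
Proof.
move=> pw0; split.
  case=> l [|a q' i l' hs aq ic hf]; rewrite /code; first by rewrite big_nil; left.
  rewrite big_cons -/(code l') => <-; right; exists a; first by rewrite ltnS.
  exists i => //; split=> //; first by rewrite leq_addr.
  by exists l' => //; rewrite addKn.
case=> [[-> ->]|[a aq [i ic [hc [l hs hl] hf]]]].
  by exists [::]; [constructor | rewrite /code big_nil].
exists (i :: l); first exact: steps_cons hs aq ic hf.
by rewrite /code big_cons -/(code l) hl subnKC.
Qed.

Variables (Y L tgt : nat).
Hypotheses (mY : m < Y) (nY : n < Y) (LY : L < Y) (tY : tgt < Y) (pY : pw <= Y).
Hypotheses (pw0 : 0 < pw) (L0 : 0 < L) (W0 : forall i, i < n -> 0 < W i).

Definition env (s : store) : Prop :=
  [/\ s.1 0 = L, s.1 2 = m, s.1 3 = n, s.1 4 = m.+1 &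
    [/\ s.1 19 = pw, s.1 20 = tgt, s.2 2 = W & s.2 3 = S]].

Lemma env_fr V A s s' : fr V A s s' -> env s ->
  (all (fun r => r \notin V) [:: 0; 2; 3; 4; 19; 20]) &&
  ((2 \notin A) && (3 \notin A)) -> env s'.
Proof.
move=> [h1 h2] [e0 e2 e3 e4 [e5 e6 ea eb]].
case/andP=> /= /and5P[n0 n2 n3 n4 /and3P[n5 n6 _]] /andP[n7 n8].
by rewrite /env !h1 ?h2.
Qed.

Let two x : x <= Y -> x < 2 ^ Y.
Proof. by move=> xY; apply: leq_ltn_trans xY (ltn_expl _ _). Qed.

(** Dividing by the weight of [i] exposes the digit of its type, which packs two cuts as
    [a * m.+1 + q]. The reductions modulo [m.+1] keep both cuts in range for every [g]. *)
Definition threshold g i := let d := (g %/ W i) %% L in segval i ((d %/ m.+1) %% m.+1) (d %% m.+1).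

Lemma threshold_correct g s : env s -> s.1 21 = g -> g <= Y ->
  wp Y threshold_prog (fun s' => forall i, i < n -> s'.2 4 i = threshold g i) s.
Proof.
move=> es eg gY; have [e0 e2 e3 e4 [e5 e6 ea eb]] := es.
apply: (@wp_for (fun k s' => forall i, i < k -> s'.2 4 i = threshold g i)) => //=;
  rewrite e3 //; first by rewrite ltnW.
move=> k s1 kn f1 ik hJ.
have [g0 g2 g3 g4 [g5 g6 ga gb]] := env_fr f1 es isT.
have g21 : s1.1 21 = g by frw f1.
wseq; wasg; wseq; apply: wp_div => //=; rewrite /= /upd /= ?ik ?ga ?g21 //.
  exact: W0.
move=> s2 f2 h12 _; wseq; apply: wp_div => //=.
- by frw f2; rewrite g0.
- by rewrite h12; apply: leq_trans gY; apply: leq_div.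
frw f2; rewrite h12 g0 => s3 f3 _ {}h12; wseq; apply: wp_div => //=.
- by frw f3; frw f2; rewrite g4.
- rewrite h12; apply: leq_trans (ltnW LY); apply: ltnW; exact: ltn_pmod.
frw f3; frw f2; rewrite h12 g4 => s4 f4 h14 {}h12; wseq; apply: wp_div => //=.
- by frw f4; frw f3; frw f2; rewrite g4.
- rewrite h14; apply: leq_trans (leq_div _ _) _; apply: leq_trans (ltnW LY).
  exact: ltnW (ltn_pmod _ _).
frw f4; frw f3; frw f2; rewrite h14 g4 => s5 f5 _ {}h14; wseq; apply: wp_mul => //=.
  by frw f5; frw f4; frw f3; frw f2; rewrite g4 two.
frw f5; frw f4; frw f3; frw f2; rewrite ik g4 => s6 f6 h15; wsto.
rewrite /= /upd /= h15; frw f6; frw f5; rewrite h12 h14; frw f4; frw f3; frw f2.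
rewrite ik gb => i; rewrite ltnS leq_eqVlt => /orP[/eqP ->|ik'].
  by rewrite eqxx.
by rewrite (ltn_eqF ik'); apply: hJ.
Qed.

Section Table.
Variable Af : nat -> nat.

Definition senv (s : store) := env s /\ (forall i, i < n -> s.2 4 i = Af i).

Lemma senv_fr V A s s' : fr V A s s' -> senv s ->
  (all (fun r => r \notin V) [:: 0; 2; 3; 4; 19; 20]) &&
  (((2 \notin A) && (3 \notin A)) && (4 \notin A)) -> senv s'.
Proof.
move=> f [es hA]; rewrite andbA => /andP[h1 h2]; split; first exact: env_fr f es h1.
by case: f => _ ->.
Qed.

(** Variable 28 records violations of [fits]. Variable 24 is only ever raised, so over all
    candidates it computes a disjunction. *)
Lemma transition_correct s a q i : senv s ->
  s.1 23 = q -> s.1 25 = a -> s.1 26 = i -> i < n ->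
  wp Y transition_prog (fun s' =>
    s'.1 24 <> 0 <-> (s.1 24 <> 0 \/ fits Af a q i)) s.
Proof.
move=> es eq ea ei ic; have [[e0 e2 e3 e4 [e5 e6 eW eS]] eA] := es.
wseq; wasg; wseq.
apply: (@wp_for (fun k s' => s'.1 28 = 0 <-> forall j, j < k -> segval j a q <= Af j))
  => //=; rewrite /= /upd /= ?e3 //; first by rewrite ltnW.
  move=> k s1 kn f1 ik hJ.
  wseq; apply: wp_mul => //=; first by frw f1; rewrite e4 two.
  frw f1; rewrite ik e4 => s2 f2 h30.
  apply: wp_ifgt; rewrite /= h30; frw f2; frw f1; rewrite ik eS eq ea eA // => hlt;
    wasg; rewrite /= /upd /=.
    split=> // /(_ k (ltnSn k)); rewrite /segval; lia.
  frw f2; rewrite hJ; split=> h j; last by move=> jk; apply: h; lia.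
  by rewrite ltnS leq_eqVlt => /orP[/eqP ->|/h].
move=> s1 f1 h28; wseq; apply: wp_mul => //=; first by frw f1; rewrite e4 two.
frw f1; rewrite ei e4 => s2 f2 h30; wseq.
apply: (@wp_use _ _ (fun s' => s'.1 28 = 0 <-> fits Af a q i)).
  apply: wp_ifgt; rewrite /= h30; frw f2; frw f1; rewrite ei eS eq ea eA // => hlt;
    wasg; rewrite /= /upd /=.
    by split=> // -[_]; rewrite /segval; lia.
  by frw f2; rewrite h28; split=> [h|[]].
move=> s3 f3 h; apply: wp_if => /= z; wasg; rewrite /= /upd /=.
  by frw f3; frw f2; frw f1; rewrite -h; split; [left | case].
by split=> // _; right; apply/h.
Qed.

Definition filled (s : store) c q := s.2 5 (c * m.+1 + q) <> 0 <-> reach Af c q.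

Lemma entry_correct s c q : senv s -> s.1 22 = c -> s.1 23 = q -> q <= m ->
  (forall c' q', c' < c -> q' <= m -> filled s c' q') ->
  wp Y entry_prog (fun s' => s'.1 24 <> 0 <-> reach Af c q) s.
Proof.
move=> es ec eq qm hT; have [[e0 e2 e3 e4 [e5 e6 eW eS]] eA] := es.
wseq; wasg.
(* The start value [1 - (c + q)] of variable 24, with truncated subtraction, is nonzero exactly in
   this base case. *)
pose B (k : nat) := (c = 0 /\ q = 0) \/
  exists2 a, a < k & exists2 i, i < n & arrives Af c q a i.
apply: (@wp_for (fun k s' => s'.1 24 <> 0 <-> B k)) => //=; rewrite /= /upd /= ?eq.
- by lia.
- by rewrite ec /B; split=> [h|[?|[]//]]; [left|]; lia.
- move=> k s1 kq f1 ik hB.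
  have es1 : senv s1 by apply: senv_fr f1 _ isT.
  have [[g0 g2 g3 g4 [g5 g6 gW gS]] gA] := es1.
  apply: (@wp_for (fun k' s' => s'.1 24 <> 0 <-> (B k \/
     exists2 i, i < k' & arrives Af c q k i))) => //=; rewrite /= /upd /= ?g3.
  + by lia.
  + by rewrite hB; split=> [h|[|[]]] //; left.
  + move=> i s2 ic f2 i26 hB2.
    have es2 : senv s2 by apply: senv_fr f2 _ isT.
    have [[c0 c2 c3 c4 [c5 c6 cW cS]] cA] := es2.
    have w22 : s2.1 22 = c by frw f2; frw f1.
    have w23 : s2.1 23 = q by frw f2; frw f1.
    have w25 : s2.1 25 = k by frw f2.
    have wT : s2.2 5 = s.2 5 by frw f2; frw f1.
    have ext : (B k \/ exists2 i', i' < i.+1 & arrives Af c q k i') <->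
        ((B k \/ exists2 i', i' < i & arrives Af c q k i') \/ arrives Af c q k i).
      split=> [[h|[i']]|[[h|[i' h1 h2]]|h]].
      - by left; left.
      - rewrite ltnS leq_eqVlt => /orP[/eqP ->|h1 h2]; first by right.
        by left; right; exists i'.
      - by left.
      - by right; exists i' => //; lia.
      - by right; exists i.
    wseq; wasg; apply: wp_ifgt; rewrite /= /upd /= i26 cW c5 w22 => hle.
      wasg; rewrite /= /upd /= ext hB2; split; first by left.
      by case=> // -[]; lia.
    wseq; apply: wp_mul => //=; rewrite /= /upd /= ?c4 ?two // ?i26 ?w22 ?cW ?c5.
    move=> s3 f3 h27.
    have i3 : s3.1 26 = i by frw f3.
    have km : k <= m by lia.
    (* Only rows of smaller code are read, and these are complete, even when the segment is empty
       and [k = q]. *)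
    have lt : c - (W i + pw) < c by lia.
    have hf := hT _ _ lt km.
    apply: wp_if; rewrite /= h27; frw f3; rewrite w25 wT => hz.
      apply: wp_use (@transition_correct s3 k q i _ _ _ _ _) _ => //.
      * by apply: senv_fr f3 _ isT; apply: senv_fr f2 _ isT.
      * by frw f3.
      * by frw f3.
      move=> s4 f4; rewrite /= /upd /= => ->; frw f3; rewrite hB2 ext.
      split; case=> h; [by left|right|by left|right]; last by case: h.
      by split=> //; apply/hf.
    wasg; rewrite /= /upd /=; frw f3; rewrite hB2 ext; split; first by left.
    by case=> // -[_ /hf /(_ hz)].
  + move=> s2 f2 ->; rewrite /B; split.
      case=> [[h|[a ak h]]|h]; [by left|right|right]; first by exists a => //; lia.
      by exists k.
    case=> [h|[a]]; first by left; left.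
    rewrite ltnS leq_eqVlt => /orP[/eqP ->|h1 h2]; first by right.
    by left; right; exists a.
- by rewrite addn1 => s1 f1 ->; rewrite reachE.
Qed.

(** Entries left over from an earlier guess do no harm: each cell is rewritten before it is read. *)
Lemma table_correct s : senv s ->
  wp Y table_prog (fun s' => forall c q, c <= tgt -> q <= m -> filled s' c q) s.
Proof.
move=> es; have [[e0 e2 e3 e4 [e5 e6 eW eS]] eA] := es.
apply: (@wp_for (fun k s' => forall c q, c < k -> q <= m -> filled s' c q)) => //=;
  rewrite e6.
- by lia.
- move=> c s1 kc f1 ic hJ.
  have es1 : senv s1 by apply: senv_fr f1 _ isT.
  have [[g0 g2 g3 g4 [g5 g6 gW gS]] gA] := es1.
  apply: (@wp_for (fun k' s' => (forall c' q, c' < c -> q <= m -> filled s' c' q) /\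
     (forall q, q < k' -> filled s' c q))) => //=; rewrite ?g4 //.
    move=> q s2 qm f2 iq [h1 h2].
    have es2 : senv s2 by apply: senv_fr f2 _ isT.
    have w22 : s2.1 22 = c by frw f2.
    have q'm : q <= m by [].
    wseq; apply: wp_use (entry_correct es2 w22 iq q'm h1) _ => s3 f3 h24.
    have [[d0 d2 d3 d4 [d5 d6 dW dS]] dA] := senv_fr f3 es2 isT.
    wseq; apply: wp_mul => //=; first by rewrite d4 two.
    rewrite d4; frw f3; rewrite w22 => s4 f4 h27; wsto.
    have w5 : s4.2 5 = s2.2 5 by frw f4; frw f3.
    have w23 : s4.1 23 = q by frw f4; frw f3.
    have w24 : s4.1 24 = s3.1 24 by frw f4.
    split=> [c' q' c'c q'm1|q']; rewrite /filled /= /upd /= h27 w23 w24 w5.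
      by rewrite (negbTE (row_neq _ c'c q'm1)); apply: h1.
    rewrite eqn_add2l ltnS leq_eqVlt => /orP[/eqP ->|q'q]; first by rewrite eqxx.
    by rewrite (ltn_eqF q'q); apply: h2.
  move=> s2 f2 [h1 h2] c' q; rewrite ltnS leq_eqVlt => /orP[/eqP ->|c'c] qm.
    exact: h2.
  exact: h1.
- by move=> s1 f1 h c q ct; apply: h; rewrite addn1 ltnS.
Qed.

End Table.

Lemma search_correct s : env s ->
  wp Y search_prog (fun s' => exists2 b : bool, s'.1 1 = b &
    (b <-> exists2 g, g < pw & reach (threshold g) tgt m)) s.
Proof.
move=> es; have [e0 e2 e3 e4 [e5 e6 eW eS]] := es.
wseq; wasg; have {}es : env (setr s 1 0) by [].
apply: (@wp_for (fun k s' => exists2 b : bool, s'.1 1 = b &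
    (b <-> exists2 g, g < k & reach (threshold g) tgt m))) => //=; rewrite /= /upd /= ?e5 //.
  by exists false => //; split=> // -[].
move=> g s1 gp f1 ig [b eb hb].
have es1 := env_fr f1 es isT.
have gY : g <= Y by lia.
wseq; apply: wp_use (threshold_correct es1 ig gY) _ => s2 f2 h2.
have es2 : senv (threshold g) s2 by split=> //; apply: env_fr f2 es1 isT.
wseq; apply: wp_use (table_correct es2) _ => s3 f3 h3.
have [[d0 d2 d3 d4 [d5 d6 dW dS]] dA] := senv_fr f3 es2 isT.
wseq; apply: wp_mul => //=; first by rewrite d4 two.
rewrite d6 d4 => s4 f4 h27.
have w1 : s4.1 1 = b by frw f4; frw f3; frw f2.
have hr := h3 tgt m (leqnn _) (leqnn _).
have ext : (exists2 g', g' < g.+1 & reach (threshold g') tgt m) <->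
  ((exists2 g', g' < g & reach (threshold g') tgt m) \/ reach (threshold g) tgt m).
  split=> [[g']|[[g' h1 h1']|h]].
  - rewrite ltnS leq_eqVlt => /orP[/eqP ->|h1 h1']; first by right.
    by left; exists g'.
  - by exists g' => //; lia.
  - by exists g.
apply: wp_if; rewrite /= h27; frw f4; rewrite d2 => hz; wasg; rewrite /= /upd /=.
  exists true => //; rewrite ext; split=> // _; right; exact/hr.
rewrite w1; exists b => //; rewrite ext hb; split; first by left.
by case=> // /hr /(_ hz).
Qed.

End Reach.

(** * Reachability and envy-free interval allocations *)

Definition expsum (L : nat) (e : seq nat) := \sum_(x <- e) L ^ x.

Lemma expsum_split L e : expsum L e =
  count_mem 0 e + L * expsum L [seq x.-1 | x <- e & x != 0].
Proof.
rewrite /expsum; elim: e => [|x e IH]; first by rewrite !big_nil muln0.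
rewrite big_cons IH /=; case: x => [|x] /=; first by lia.
by rewrite big_cons mulnDr expnS; lia.
Qed.

(** With fewer than [L] terms nothing carries: the multiplicity of 0 is the lowest digit in base
    [L], and dividing by [L] lowers the other exponents by one. *)
Lemma expsum_count L e1 e2 : size e1 < L -> size e2 < L ->
  expsum L e1 = expsum L e2 -> forall c, count_mem c e1 = count_mem c e2.
Proof.
move=> h1 h2 h c; elim: c e1 e2 h1 h2 h => [|c IH] e1 e2 h1 h2.
  rewrite !(expsum_split _ e1, expsum_split _ e2) => h.
  have c1 := leq_ltn_trans (count_size (pred1 0) e1) h1.
  have c2 := leq_ltn_trans (count_size (pred1 0) e2) h2.
  have := congr1 (modn^~ L) h; rewrite /= !(addnC (count_mem 0 _)) !(mulnC L).
  by rewrite !modnMDl !modn_small.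
rewrite !(expsum_split _ e1, expsum_split _ e2) => h.
have c1 := leq_ltn_trans (count_size (pred1 0) e1) h1.
have c2 := leq_ltn_trans (count_size (pred1 0) e2) h2.
have := congr1 (divn^~ L) h; rewrite /= !(addnC (count_mem 0 _)) !(mulnC L).
rewrite !divnMDl ?(leq_ltn_trans _ h1) // !divn_small // !addn0 => {}h.
have sz (e : seq nat) : size [seq x.-1 | x <- e & x != 0] <= size e.
  by rewrite size_map size_filter count_size.
have cm (e : seq nat) : count_mem c [seq x.-1 | x <- e & x != 0] = count_mem c.+1 e.
  by elim: e => //= -[|x] e; [rewrite add0n | rewrite /= => ->; rewrite eqSS].
by rewrite -!cm; apply: IH => //; apply: leq_ltn_trans (sz _) _.
Qed.

Lemma expsum_lt L d e : size e < L -> all (fun x => x < d) e -> expsum L e < L ^ d.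
Proof.
move=> eL ed; have L0 : 0 < L by apply: leq_ltn_trans eL.
have h : expsum L e * L <= size e * L ^ d.
  rewrite /expsum; elim: e ed {eL} => [|x e IH] /=; first by rewrite big_nil.
  case/andP=> xd /IH {}IH; rewrite big_cons mulnDl mulSn leq_add //.
  by rewrite -expnSr leq_pexp2l.
have p0 : 0 < L ^ d by rewrite expn_gt0 L0.
rewrite -(ltn_pmul2r L0); apply: leq_ltn_trans h _.
by rewrite mulnC ltn_pmul2l.
Qed.

(** Only [e2] is known to be short, as [e1] stems from an arbitrary run. Since [expsum L e2] is
    below [L ^ d], the multiples of [L ^ d] reveal the lengths first, and then the digits can be
    compared. *)
Lemma expsum_perm L d e1 e2 :
  size e2 < L -> all (fun x => x < d) e1 -> all (fun x => x < d) e2 ->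
  expsum L e1 + size e1 * L ^ d = expsum L e2 + size e2 * L ^ d -> perm_eq e1 e2.
Proof.
move=> s2 a1 a2 h.
have lt2 := expsum_lt s2 a2.
have sz : size e1 = size e2.
  case: (ltngtP (size e1) (size e2)) => // hs.
    have lt1 := expsum_lt (ltn_trans hs s2) a1.
    have : (size e1).+1 * L ^ d <= size e2 * L ^ d by rewrite leq_mul2r hs orbT.
    by rewrite mulSn; lia.
  have : (size e2).+1 * L ^ d <= size e1 * L ^ d by rewrite leq_mul2r hs orbT.
  by rewrite mulSn; lia.
have s1 : size e1 < L by rewrite sz.
apply/allP => x _ /=; apply/eqP; apply: (expsum_count s1 s2).
by move: h; rewrite sz; lia.
Qed.

Lemma digits_exist L d (dd : nat -> nat) : (forall c, c < d -> dd c < L) ->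
  exists2 g, g < L ^ d & forall c, c < d -> (g %/ L ^ c) %% L = dd c.
Proof.
elim: d dd => [|d IH] dd h; first by exists 0.
have L0 : 0 < L by apply: leq_ltn_trans (h 0 _).
have [g gl hg] := IH (fun c => dd c.+1) (fun c hc => h c.+1 hc).
exists (g * L + dd 0).
  have : g.+1 * L <= L ^ d * L by rewrite leq_mul2r gl orbT.
  have := h 0 isT; rewrite expnSr mulSn; lia.
case=> [|c] hc; first by rewrite expn0 divn1 modnMDl modn_small // h.
rewrite expnS divnMA divnMDl // (divn_small (h 0 _)) // addn0.
exact: hg.
Qed.

Section Intervals.
Variables (m n L d : nat) (S W t : nat -> nat).
Hypotheses (nL : n < L) (mL : m.+1 * m.+1 <= L).
Hypothesis (hW : forall i, i < n -> W i = L ^ t i /\ t i < d).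
Hypothesis (hS : forall i j, i < n -> j < n -> t i = t j ->
  forall q, q <= m -> S (i * m.+1 + q) = S (j * m.+1 + q)).

Notation seg := (segval m S).
Notation thr := (threshold m W S L).

Definition interval_allocation (lo hi : nat -> nat) : Prop :=
  [/\ forall i, i < n -> lo i <= hi i <= m,
      forall k, k < m -> exists2 i, i < n & lo i <= k < hi i &
      forall k i j, i < n -> j < n -> lo i <= k < hi i -> lo j <= k < hi j -> i = j].

Definition interval_EF : Prop := exists lo hi, interval_allocation lo hi /\
  forall i j, i < n -> j < n -> seg i (lo j) (hi j) <= seg i (lo i) (hi i).

Lemma seg_same i j a q : i < n -> j < n -> t i = t j -> a <= m -> q <= m ->
  seg i a q = seg j a q.
Proof. by move=> ic jc tij am qm; rewrite /segval !(hS ic jc tij). Qed.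

Lemma thr_same g i j : i < n -> j < n -> t i = t j -> thr g i = thr g j.
Proof.
move=> ic jc tij; rewrite /threshold (hW ic).1 (hW jc).1 -tij.
by apply: seg_same => //; rewrite -ltnS ltn_pmod.
Qed.

Lemma steps_bound Af q l : steps m n S Af q l -> all (fun i => i < n) l.
Proof. by elim=> //= a q' i l' _ h _ -> _. Qed.

Lemma steps_relabel g q l l' : steps m n S (thr g) q l -> q <= m ->
  all (fun i => i < n) l' -> [seq t i | i <- l] = [seq t i | i <- l'] ->
  steps m n S (thr g) q l'.
Proof.
move=> h; elim: h l' => [|a q' i l1 _ IH aq ic [f1 f2]] [|i' l'] //= q'm.
  by move=> _ _; constructor.
case/andP=> i'c l'c [ti hl]; apply: (@steps_cons _ _ _ _ a) => //.
  by apply: IH => //; apply: leq_trans q'm.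
split=> //; rewrite -(thr_same g ic i'c ti) -(seg_same ic i'c ti) //.
exact: leq_trans q'm.
Qed.

Lemma steps_allocation Af q l : steps m n S Af q l -> uniq l ->
  exists lo hi, [/\ forall i, i \in l -> lo i <= hi i <= q /\
      fits m n S Af (lo i) (hi i) i,
    forall k, k < q -> exists2 i, i \in l & lo i <= k < hi i &
    forall k i j, i \in l -> j \in l -> lo i <= k < hi i -> lo j <= k < hi j -> i = j].
Proof.
elim=> [|a q' i l' _ IH aq ic hf] /=; first by exists id, id.
case/andP=> il' /IH [lo [hi [h1 h2 h3]]].
pose lo' x := if x == i then a else lo x; pose hi' x := if x == i then q' else hi x.
have ne j : j \in l' -> (j == i) = false.
  by move=> jl; apply: contraNF il' => /eqP <-.
exists lo', hi'; split.
- move=> j; rewrite inE /lo' /hi' => /orP[/eqP ->|jl].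
    by rewrite !eqxx aq leqnn.
  rewrite (ne _ jl); have [h1' hf'] := h1 j jl; split=> //; lia.
- move=> k kq; case: (ltnP k a) => ka; last first.
    by exists i; rewrite ?inE /lo' /hi' ?eqxx // ka kq.
  have [j jl hj] := h2 k ka; exists j; first by rewrite inE jl orbT.
  by rewrite /lo' /hi' (ne _ jl).
- move=> k j j'; rewrite !inE /lo' /hi' => /orP[/eqP ->|jl] /orP[/eqP ->|jl'] //;
    rewrite ?eqxx ?(ne _ jl) ?(ne _ jl').
  + by move=> k1 k2; have [] := h1 j' jl'; lia.
  + by move=> k1 k2; have [] := h1 j jl; lia.
  + exact: h3.
Qed.

Let pw := L ^ d.
Let tgt := \sum_(0 <= i < n) (W i + pw).

Lemma codeE l : all (fun i => i < n) l ->
  code pw W l = expsum L [seq t i | i <- l] + size [seq t i | i <- l] * L ^ d.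
Proof.
rewrite /code /expsum; elim: l => [|i l IH] /=; first by rewrite !big_nil.
case/andP=> ic /IH h; rewrite !big_cons h (hW ic).1 mulSn /pw; lia.
Qed.

Lemma reach_interval_EF g : reach m n pw W S (thr g) tgt m -> interval_EF.
Proof.
case=> l hs hc.
have lb := steps_bound hs.
have ib : all (fun i => i < n) (iota 0 n) by apply/allP => i; rewrite mem_iota.
have perm : perm_eq [seq t i | i <- l] [seq t i | i <- iota 0 n].
  apply: (@expsum_perm L d).
  - by rewrite size_map size_iota.
  - by apply/allP => _ /mapP[i /(allP lb) ic ->]; have [] := hW ic.
  - by apply/allP => _ /mapP[i /(allP ib) ic ->]; have [] := hW ic.
  - rewrite -!codeE // hc /tgt /code /index_iota subn0 //.
(* The permutation of types is lifted to one of players: [u] serves everyone once and has the type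
   sequence of [l]. *)
have [u pu hu] : exists2 u, perm_eq u (iota 0 n) &
    [seq t i | i <- l] = [seq t i | i <- u].
  case/(perm_iotaP 0): perm => Is; rewrite size_map size_iota => pI ->.
  exists Is => //; apply/eq_in_map => i; rewrite (perm_mem pI) => iI.
  by move: iI; rewrite mem_iota => /andP[_ iI]; rewrite (nth_map 0) ?size_iota // nth_iota.
have ub : all (fun i => i < n) u by rewrite (perm_all _ pu).
have um i : (i \in u) = (i < n) by rewrite (perm_mem pu) mem_iota.
have hs' := steps_relabel hs (leqnn _) ub hu.
have uu : uniq u by rewrite (perm_uniq pu) iota_uniq.
have [lo [hi [h1 h2 h3]]] := steps_allocation hs' uu.
exists lo, hi; split; first split.
- by move=> i ic; have [|//] := h1 i; rewrite um.
- by move=> k /h2 [i iu hk]; exists i; rewrite -?um.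
- by move=> k i j ic jc; apply: h3; rewrite um.
- move=> i j ic jc; have [|_ [_ f2]] := h1 i; first by rewrite um.
  have [|_ [f1 _]] := h1 j; first by rewrite um.
  exact: leq_trans (f1 i ic) f2.
Qed.

Lemma interval_EF_reach : interval_EF ->
  exists2 g, g < pw & reach m n pw W S (thr g) tgt m.
Proof.
case=> lo [hi [[lohi cov uni] ef]].
pose rep c := nth 0 (iota 0 n) (find (fun i => t i == c) (iota 0 n)).
have repP i : i < n -> rep (t i) < n /\ t (rep (t i)) = t i.
  move=> ic; have hh : has (fun j => t j == t i) (iota 0 n).
    by apply/hasP; exists i; rewrite ?mem_iota.
  split; last by apply/eqP; apply: (nth_find 0 hh).
  have : rep (t i) \in iota 0 n by apply: mem_nth; rewrite -has_find.
  by rewrite mem_iota.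
(* A number that is no player's type gets an arbitrary digit in range. *)
pose dd c := if rep c < n then lo (rep c) * m.+1 + hi (rep c) else 0.
have [|g gl hg] := @digits_exist L d dd.
  move=> c _; rewrite /dd; case: ifP => [/lohi|_]; last by apply: leq_trans nL.
  case/andP=> h1 h2; apply: leq_trans mL.
  have : lo (rep c) * m.+1 <= m * m.+1 by rewrite leq_mul2r (leq_trans h1 h2) orbT.
  rewrite mulSn; lia.
exists g => //.
have thrE i : i < n -> thr g i = seg i (lo i) (hi i).
  move=> ic; rewrite /threshold (hW ic).1 hg; last by case: (hW ic).
  have [rc tr] := repP i ic; rewrite /dd rc; set r := rep _ in rc tr *.
  have /andP[r1 r2] := lohi _ rc; have /andP[i1 i2] := lohi _ ic.
  rewrite divnMDl // divn_small ?ltnS // addn0 modnMDl !modn_small ?ltnS //; last first.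
    exact: leq_trans r2.
  (* Neither [i] nor its representative [r] envies the other and both have the same utilities, hence
     their own values coincide. *)
  apply/eqP; rewrite eqn_leq ef //=.
  have lor : lo r <= m by apply: leq_trans r2.
  have loi : lo i <= m by apply: leq_trans i2.
  by rewrite (seg_same ic rc) // (seg_same ic rc) // ef.
have fitsE i : i < n -> fits m n S (thr g) (lo i) (hi i) i.
  move=> ic; split; first by move=> j jc; rewrite thrE // ef.
  by rewrite thrE.
have seg0 i a : seg i a a = 0 by rewrite /segval subnn.
(* players with empty segments are served first; afterwards the player owning the
   item just before a cut q also owns the last segment of [0, q) *)
have [l0 [s0 u0 m0]] : exists l0, [/\ steps m n S (thr g) 0 l0, uniq l0 &
    forall i, i \in l0 = (i < n) && (lo i == hi i)].
  suff [l0 [s0 u0 m0]] : exists l0, [/\ steps m n S (thr g) 0 l0, uniq l0 &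
    forall i, i \in l0 = (i \in iota 0 n) && (lo i == hi i)].
    by exists l0; split=> // i; rewrite m0 mem_iota.
  have : all (fun i => i < n) (iota 0 n) by apply/allP => i; rewrite mem_iota.
  elim: (iota 0 n) (iota_uniq 0 n) => [_ _|i l IH /= /andP[il ul] /andP[ic lc]].
    by exists [::]; split=> //; constructor.
  have [l0 [s0 u0 m0]] := IH ul lc.
  case: (altP (lo i =P hi i)) => hi0.
    exists (i :: l0); split.
    - apply: (steps_cons s0) => //; split=> [j jc|]; first by rewrite seg0.
      by rewrite thrE // hi0 !seg0.
    - by rewrite /= u0 m0 (negbTE il).
    - by move=> j; rewrite !inE m0; case: eqP => // ->; rewrite hi0 eqxx.
  exists l0; split=> // j; rewrite m0 inE; case: (altP (j =P i)) => //= ->.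
  by rewrite (negbTE il) (negbTE hi0).
have build q : q <= m -> (forall i, i < n -> lo i < hi i -> hi i <= q \/ q <= lo i) ->
  exists l, [/\ steps m n S (thr g) q l, uniq l &
    forall i, i \in l = (i < n) && ((lo i == hi i) || (hi i <= q))].
  elim/ltn_ind: q => -[|q] IH qm cut.
    exists l0; split=> // i; rewrite m0; case: (ltnP i n) => //= /lohi; lia.
  have [i ic /andP[k1 k2]] := cov q qm.
  have hiq : hi i = q.+1 by case: (cut i ic) => //; lia.
  have /andP[i1 i2] := lohi i ic.
  have [|||l [sl ul ml]] := IH (lo i) => //.
  - by lia.
  (* A segment straddling [lo i] would contain the item at [lo i], which belongs to [i]. *)
  - move=> j jc jne; case: (leqP (hi j) (lo i)) => h1; first by left.
    case: (leqP (lo i) (lo j)) => h2; first by right.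
    have := uni (lo i) i j ic jc; move: h2 h1; case: (eqVneq i j) => [->|/eqP ne]; lia.
  have ne : i \notin l by rewrite ml ic; lia.
  exists (i :: l); split=> /=.
  - apply: (steps_cons sl) => //; first by lia.
    by rewrite -hiq; apply: fitsE.
  - by rewrite ne.
  move=> j; rewrite inE ml; case: (altP (j =P i)) => [->|ji] /=.
    by rewrite ic hiq leqnn orbT.
  case: (ltnP j n) => //= jc; case: (altP (lo j =P hi j)) => //= hj0.
  have /andP[j1 j2] := lohi j jc.
  have jne : lo j < hi j by rewrite ltn_neqAle hj0.
  apply/idP/idP => h; first by lia.
  rewrite leqNgt; apply/negP => h1; move/eqP: ji; apply.
  by apply: (uni (hi j).-1) => //; lia.
have [|l [sl ul ml]] := build m (leqnn _).
  by move=> i /lohi; lia.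
exists l => //.
have pl : perm_eq l (iota 0 n).
  apply: uniq_perm => //; first exact: iota_uniq.
  move=> i; rewrite ml mem_iota /=; case: (ltnP i n) => //= /lohi /andP[_ ->].
  by rewrite orbT.
by rewrite /code /tgt (perm_big _ pl) /index_iota subn0.
Qed.

End Intervals.

(** * Connected sets of a path are intervals *)

(** Induction on [m]: a new last element either starts the interval or, by convexity, extends it
    across any gap. *)
Lemma convex_interval (A : pred nat) m :
  (forall a b c, A a -> A c -> a <= b <= c -> A b) ->
  exists p : nat * nat, p.1 <= p.2 <= m /\ forall k, k < m -> A k = (p.1 <= k < p.2).
Proof.
move=> cvx; elim: m => [|m [[lo hi] /= [h1 h2]]]; first by exists (0, 0).
case Am: (A m); last first.
  exists (lo, hi) => /=; split; first by lia.
  move=> k; rewrite ltnS leq_eqVlt => /orP[/eqP ->|/h2 //]; rewrite Am; lia.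
case: (ltnP lo hi) => lh; last first.
  exists (m, m.+1) => /=; split; first by lia.
  by move=> k; rewrite ltnS leq_eqVlt => /orP[/eqP ->|km]; rewrite ?Am ?h2 //; lia.
have Alo : A lo by rewrite h2; lia.
exists (lo, m.+1) => /=; split; first by lia.
move=> k; rewrite ltnS leq_eqVlt => /orP[/eqP ->|km]; first by rewrite Am; lia.
case: (leqP lo k) => lk; last by rewrite h2 //; lia.
by rewrite (cvx lo k m) //; lia.
Qed.

Section PathGraph.
Variables (m n : nat) (adj : rel 'I_m) (u : 'I_n -> 'I_m -> rat) (s : {perm 'I_m}).
Hypothesis adjE : forall x y : 'I_m,
  adj x y = ((s x).+1 == s y)%N || ((s y).+1 == s x)%N.

(** A discrete intermediate value theorem: an edge changes the position by exactly one. *)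
Lemma path_crossing (X : {set 'I_m}) x p k :
  path [rel a b | [&& adj a b, a \in X & b \in X]] x p -> x \in X ->
  s x <= k <= s (last x p) -> exists2 z, z \in X & s z = k :> nat.
Proof.
elim: p x => [|y p IH] x /=.
  by move=> _ xX h; exists x => //; lia.
case/andP=> /and3P[xy _ yX] hp xX h.
case: (leqP (s y) k) => yk; first by apply: IH hp yX _; lia.
by exists x => //; move: xy; rewrite adjE; lia.
Qed.

Lemma connected_convex (X : {set 'I_m}) a b c x z : induces_connected adj X ->
  x \in X -> s x = a :> nat -> z \in X -> s z = c :> nat -> a <= b <= c ->
  exists2 y, y \in X & s y = b :> nat.
Proof.
move=> hX xX sx zX sz h; have /connectP[p hp lp] := hX x z xX zX.
by apply: path_crossing hp xX _; rewrite -lp; lia.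
Qed.

Lemma interval_connected lo hi :
  induces_connected adj [set x : 'I_m | lo <= s x < hi].
Proof.
move=> x y; set X := [set x | _].
set e := [rel a b | _].
have up k (a b : 'I_m) : (s b = s a + k :> nat)%N -> a \in X -> b \in X ->
    connect e a b /\ connect e b a.
  elim: k a => [|k IH] a sab aX bX.
    have -> : a = b by apply: (@perm_inj _ s); apply: val_inj => /=; lia.
    by [].
  have lt : (s a).+1 < m by have := ltn_ord (s b); lia.
  pose c := (s^-1)%g (Ordinal lt).
  have sc : s c = (s a).+1 :> nat by rewrite /c permKV.
  have cX : c \in X by move: aX bX; rewrite !inE sc; lia.
  have [cb bc] := IH c (ltac:(lia)) cX bX.
  have ac : e a c /\ e c a by rewrite /= !adjE aX cX sc eqxx orbT.
  by split; [apply: connect_trans cb | apply: connect_trans bc _];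
    apply: connect1; case: ac.
move=> xX yX; case: (leqP (s x) (s y)) => h.
  by have [] := up (s y - s x) x y (ltac:(lia)) xX yX.
by have [] := up (s x - s y) y x (ltac:(lia)) yX xX.
Qed.

Variables (S : nat -> nat) (D : 'I_n -> rat).
Hypothesis D_gt0 : forall i, (0 < D i)%R.
Hypothesis u_ge0 : forall i v, (0 <= u i v)%R.
Hypothesis SE : forall (i : 'I_n) q, q <= m ->
  ((S (i * m.+1 + q))%:R = D i * \sum_(x : 'I_m | (s x < q)%N) u i x)%R.

(** Nonnegative utilities make [S] monotone along a row, so the subtraction in [segval] is never
    truncated. *)
Lemma segE (i : 'I_n) a q : a <= q <= m ->
  ((segval m S i a q)%:R = D i * \sum_(x : 'I_m | (a <= s x < q)%N) u i x)%R.
Proof.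
case/andP=> aq qm; have am := leq_trans aq qm.
have split_sum : (\sum_(x : 'I_m | (s x < q)%N) u i x =
    \sum_(x : 'I_m | (s x < a)%N) u i x + \sum_(x : 'I_m | (a <= s x < q)%N) u i x)%R.
  rewrite (bigID (fun x : 'I_m => s x < a)) /=; congr (_ + _)%R;
    by apply: eq_bigl => x; lia.
have le : S (i * m.+1 + a) <= S (i * m.+1 + q).
  rewrite -(ler_nat rat) !SE // ler_pM2l // split_sum lerDl.
  exact: sumr_ge0.
by rewrite /segval natrB // !SE // split_sum mulrDr addrAC subrr add0r.
Qed.

Lemma seg_le (i : 'I_n) a q a' q' : a <= q <= m -> a' <= q' <= m ->
  (segval m S i a q <= segval m S i a' q') =
  (\sum_(x : 'I_m | (a <= s x < q)%N) u i x <= \sum_(x : 'I_m | (a' <= s x < q')%N) u i x)%R.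
Proof. by move=> h h'; rewrite -(ler_nat rat) !segE // ler_pM2l. Qed.

Lemma has_complete_EF_interval : has_complete_EF adj u <-> interval_EF m n S.
Proof.
split.
  case=> pi [[con dis] ef cpl].
  have mkint (i : 'I_n) : exists p : nat * nat, p.1 <= p.2 <= m /\
      forall x : 'I_m, (x \in pi i) = (p.1 <= s x < p.2).
    have [|p [h1 h2]] := @convex_interval
      (fun k => [exists x, (x \in pi i) && (s x == k :> nat)]) m.
      move=> a b c /existsP[x /andP[xX /eqP sx]] /existsP[z /andP[zX /eqP sz]] h.
      have [y yX sy] := connected_convex (con i) xX sx zX sz h.
      by apply/existsP; exists y; rewrite yX sy eqxx.
    exists p; split=> // x; rewrite -h2 //; apply/idP/existsP => [xX|[y /andP[yX]]].
      by exists x; rewrite xX eqxx.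
    by move=> /eqP sy; have -> : x = y by apply: (@perm_inj _ s); apply: val_inj.
  have [p hp] := fin_all_exists mkint.
  pose P k : nat * nat := if insub k is Some i then p i else (0, 0).
  have PE (i : 'I_n) : P i = p i by rewrite /P valK.
  have utilE (i j : 'I_n) : util u i (pi j) =
      (\sum_(x : 'I_m | ((P j).1 <= s x < (P j).2)%N) u i x)%R.
    by rewrite /util; apply: eq_bigl => x; rewrite PE (hp j).2.
  have bnd k : k < n -> (P k).1 <= (P k).2 <= m.
    by move=> kn; have := (hp (Ordinal kn)).1; rewrite -PE.
  have memP (k : nat) (kn : k < n) (x : 'I_m) :
      (x \in pi (Ordinal kn)) = ((P k).1 <= s x < (P k).2).
    by rewrite (hp (Ordinal kn)).2 -PE.
  exists (fun k => (P k).1), (fun k => (P k).2); split; first split=> //.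
  - move=> k km; pose x := (s^-1)%g (Ordinal km).
    have sx : s x = k :> nat by rewrite /x permKV.
    have : x \in \bigcup_i pi i by rewrite cpl inE.
    by case/bigcupP => i _; rewrite (hp i).2 -PE sx => h; exists i.
  - move=> k i j ic jc hi hj; have [km|km] := ltnP k m; last first.
      by have := bnd i ic; lia.
    pose x := (s^-1)%g (Ordinal km); have sx : s x = k :> nat by rewrite /x permKV.
    have xi : x \in pi (Ordinal ic) by rewrite memP sx.
    have xj : x \in pi (Ordinal jc) by rewrite memP sx.
    case: (altP (Ordinal ic =P Ordinal jc)) => [[]//|/dis].
    by rewrite disjoint_subset => /subsetP/(_ x xi); rewrite inE xj.
  - move=> i j ic jc; have := ef (Ordinal ic) (Ordinal jc); rewrite !utilE /=.
    by rewrite -(seg_le (Ordinal ic)) //; apply: bnd.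
case=> lo [hi [[bnd cov uni] ef]].
pose pi (i : 'I_n) := [set x : 'I_m | lo i <= s x < hi i].
exists pi; split; first split.
- by move=> i; apply: interval_connected.
- move=> i j ij; rewrite disjoint_subset; apply/subsetP => x; rewrite !inE => hi'.
  apply/negP => hj; move/eqP: ij; apply; apply: val_inj.
  exact: (uni (s x) i j).
- move=> i j; rewrite /util !(eq_bigl _ _ (in_set _)) -(seg_le i) ?bnd //.
  exact: ef.
- apply/setP => x; rewrite inE; have [k kn hk] := cov (s x) (ltn_ord _).
  by apply/bigcupP; exists (Ordinal kn) => //; rewrite inE.
Qed.

End PathGraph.

(** * Reading the encoding *)

Lemma size_flatten_const (T : Type) (f : T -> seq nat) c (l : seq T) :
  (forall x, size (f x) = c) -> size (flatten [seq f x | x <- l]) = size l * c.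
Proof. by move=> h; elim: l => //= x l IH; rewrite size_cat h IH mulSn. Qed.

Lemma nth_flatten_const (T : Type) (f : T -> seq nat) c (l : seq T) x0 k v :
  (forall x, size (f x) = c) -> k < size l -> v < c ->
  nth 0 (flatten [seq f x | x <- l]) (k * c + v) = nth 0 (f (nth x0 l k)) v.
Proof.
move=> h; elim: l k => //= x l IH [|k] /= kl vc; rewrite nth_cat h.
  by rewrite mul0n add0n vc.
have -> : k.+1 * c + v = c + (k * c + v) by rewrite mulSn addnA.
by rewrite ltnNge leq_addr /= addKn IH.
Qed.

Section Encoding.
Variables (m n : nat) (adj : rel 'I_m) (u : 'I_n -> 'I_m -> rat).
Notation enc := (encode adj u).

Let urow i := flatten [seq [:: `|numq (u i v)|%N; `|denq (u i v)|%N] | v <- enum 'I_m].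

Let size_urow i : size (urow i) = m * 2.
Proof. by rewrite (@size_flatten_const _ _ 2) // size_enum_ord. Qed.

Let size_adj : size [seq nat_of_bool (adj i j) | i <- enum 'I_m, j <- enum 'I_m] = m * m.
Proof. by rewrite size_allpairs size_enum_ord. Qed.

Lemma size_encode : size enc = 2 + m * m + n * (m * 2).
Proof.
rewrite /encode !size_cat size_adj (@size_flatten_const _ _ (m * 2)) ?size_enum_ord.
  by rewrite addnA.
by move=> i; apply: size_urow.
Qed.

Lemma nth_encode_adj (x y : 'I_m) : nth 0 enc (2 + (x * m + y)) = adj x y.
Proof.
have lt : x * m + y < m * m.
  have := ltn_ord x; have := ltn_ord y => ym xm.
  have : x.+1 * m <= m * m by rewrite leq_mul2r xm orbT.
  rewrite mulSn; lia.
rewrite /encode nth_cat /= -[2 + _]/(_.+2) subSS subn1 /= nth_cat size_adj lt.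
rewrite (@nth_flatten_const _ _ m _ x) ?size_enum_ord //; last first.
  by move=> z; rewrite size_map size_enum_ord.
by rewrite (nth_map y) ?size_enum_ord // !nth_ord_enum.
Qed.

Lemma nth_encode_util (i : 'I_n) (v : 'I_m) b : b < 2 ->
  nth 0 enc (2 + (m * m + (i * m + i * m + (v + v + b)))) =
  if b == 0 then `|numq (u i v)|%N else `|denq (u i v)|%N.
Proof.
move=> b2.
rewrite /encode nth_cat /= -[2 + _]/(_.+2) subSS subn1 /= nth_cat size_adj.
rewrite ltnNge leq_addr /= addKn.
have -> : i * m + i * m = i * (m * 2) by lia.
have vm := ltn_ord v.
rewrite (@nth_flatten_const _ _ (m * 2) _ i) ?size_enum_ord //; last by lia.
rewrite nth_ord_enum; have -> : v + v + b = v * 2 + b by lia.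
rewrite (@nth_flatten_const _ _ 2 _ v) ?size_enum_ord // nth_ord_enum.
by case: b b2 => [|[]].
Qed.

Variables (inp : nat -> nat).
Hypothesis inpE : forall j, 0 < j <= size enc -> inp j = nth 0 enc j.-1.

Lemma adjnE (x y : 'I_m) : adjn m inp x y = adj x y.
Proof.
rewrite /adjn inpE ?size_encode -?nth_encode_adj; first by congr nth; lia.
have := ltn_ord x; have := ltn_ord y => ym xm.
have : x.+1 * m <= m * m by rewrite leq_mul2r xm orbT.
rewrite mulSn; lia.
Qed.

Let util_bound (i : 'I_n) (v : 'I_m) b : b < 2 ->
  0 < rown m i + v + v + b <= size enc.
Proof.
move=> b2; have := ltn_ord i; have := ltn_ord v => vm im.
have : i.+1 * (m * 2) <= n * (m * 2) by rewrite leq_mul2r im orbT.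
rewrite size_encode /rown mulSn; lia.
Qed.

Lemma numnE (i : 'I_n) (v : 'I_m) : numn m inp i v = `|numq (u i v)|%N.
Proof.
have := @util_bound i v 0 isT; rewrite addn0 => /inpE.
rewrite /numn => ->; rewrite -[RHS](@nth_encode_util i v 0 isT) /rown; congr nth; lia.
Qed.

Lemma dennE (i : 'I_n) (v : 'I_m) : denn m inp i v = `|denq (u i v)|%N.
Proof.
have := inpE (@util_bound i v 1 isT).
rewrite /denn => ->; rewrite -[RHS](@nth_encode_util i v 1 isT) /rown; congr nth; lia.
Qed.

Hypothesis u_ge0 : forall i v, (0 <= u i v)%R.

Lemma utilityE (i : 'I_n) (v : 'I_m) :
  (u i v * (denn m inp i v)%:R = (numn m inp i v)%:R)%R.
Proof.
rewrite numnE dennE.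
have n0 : (0 <= numq (u i v))%R by rewrite numq_ge0.
rewrite !pmulrn !abszE gtr0_norm ?denq_gt0 // ger0_norm //.
by rewrite -[X in (X * _)%R]divq_num_den divfK // intr_eq0 denq_neq0.
Qed.

Lemma denn_gt0 (i : 'I_n) (v : 'I_m) : 0 < denn m inp i v.
Proof. by rewrite dennE absz_gt0 denq_neq0. Qed.

(** Comparing rows literally is correct because [numq] and [denq] are canonical, and nonnegativity
    makes the absolute values lossless. *)
Lemma samenP (i j : 'I_n) : samen m inp i j <-> forall v, u i v = u j v.
Proof.
split=> [h v|h w wm].
  have vm := ltn_ord v.
  have e1 : numn m inp i v = numn m inp j v.
    by have := h (v + v) (ltac:(lia)); rewrite /numn !addnA.
  have e2 : denn m inp i v = denn m inp j v.
    by have := h (v + v + 1) (ltac:(lia)); rewrite /denn !addnA.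
  have d0 : ((denn m inp j v)%:R != 0 :> rat)%R by rewrite pnatr_eq0 -lt0n denn_gt0.
  by apply: (mulIf d0); rewrite utilityE -e1 -e2 utilityE.
have vm : w./2 < m by lia.
have numE k : numn m inp k (Ordinal vm) = inp (rown m k + (w./2 + w./2)).
  by rewrite /numn addnA.
have denE k : denn m inp k (Ordinal vm) = inp (rown m k + (w./2 + w./2 + 1)).
  by rewrite /denn !addnA.
case ow: (odd w).
  have -> : w = w./2 + w./2 + 1 by lia.
  by rewrite -!denE !dennE h.
have -> : w = w./2 + w./2 by lia.
by rewrite -!numE !numnE h.
Qed.

Lemma typing_num_types L W pw t d : typing L m inp n W pw t d -> d <= num_types u.
Proof.
case=> _ _ ht hd.
have ex (c : 'I_d) : exists i : 'I_n, t i = c.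
  by have [i ic tc] := hd c (ltn_ord c); exists (Ordinal ic).
have [r hr] := fin_all_exists ex.
pose f (i : 'I_n) : {ffun 'I_m -> rat} := [ffun v => u i v].
have -> : d = size [seq f (r c) | c <- enum 'I_d] by rewrite size_map size_enum_ord.
apply: uniq_leq_size.
  rewrite map_inj_uniq ?enum_uniq // => c c' /ffunP h; apply: val_inj => /=.
  rewrite -!hr; apply/ht => //; apply/samenP => v.
  by have := h v; rewrite !ffunE.
by move=> _ /mapP[c _ ->]; rewrite mem_undup; apply: map_f; rewrite mem_enum.
Qed.

Lemma Sn_sum (s : {perm 'I_m}) (ord : nat -> nat) (i : 'I_n) q : q <= m ->
  (forall k, k < m -> exists2 x : 'I_m, ord k = x :> nat & s x = k :> nat) ->
  ((Sn m inp ord i q)%:R = (\prod_(x : 'I_m) (denn m inp i x)%:R) *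
     \sum_(x : 'I_m | (s x < q)%N) u i x)%R.
Proof.
move=> + hord; elim: q => [|q IH] qm.
  by rewrite /Sn big_nil [X in (_ * X)%R]big_pred0 ?mulr0.
have [x0 ox sx] := hord q qm.
rewrite /Sn big_nat_recr //= natrD IH ?(ltnW qm) //.
rewrite [X in _ = (_ * X)%R](bigD1 x0) ?sx //= mulrDr addrC; congr (_ + _)%R; last first.
  congr (_ * _)%R; apply: eq_bigl => x; rewrite ltnS [in RHS]leq_eqVlt.
  have -> : (s x == q :> nat) = (x == x0).
    by rewrite -sx; apply/eqP/eqP => [h|-> //]; apply: (@perm_inj _ s); apply: val_inj.
  by case: eqP => [->|_] /=; rewrite ?sx ?ltnn ?andbT.
rewrite ox /wn big_mkord natrM natr_prod -utilityE [in RHS](bigD1 x0) //=.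
by rewrite -mulrA mulrC.
Qed.

End Encoding.

(** * The whole algorithm *)

Definition path_order (m : nat) (adj : rel 'I_m) (s : {perm 'I_m}) : Prop :=
  forall x y : 'I_m, adj x y = ((s x).+1 == s y)%N || ((s y).+1 == s x)%N.

Section Endpoints.
Variables (m : nat) (adj : rel 'I_m) (s : {perm 'I_m}).
Hypothesis adjE : path_order adj s.

Lemma path_endpoint_exists : 0 < m -> exists x : 'I_m, #|adj x| <= 1.
Proof.
move=> m0; exists ((s^-1)%g (Ordinal m0)); apply/card_le1_eqP => y z.
rewrite /in_mem /= !adjE permKV /= => hy hz.
by apply: (@perm_inj _ s); apply: val_inj => /=; lia.
Qed.

Lemma path_endpoint_pos (x : 'I_m) : #|adj x| <= 1 -> s x = 0 :> nat \/ s x = m.-1 :> nat.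
Proof.
move/card_le1_eqP => h; case: (posnP (s x)) => sx; [by left|right].
have sm := ltn_ord (s x); case: (ltnP (s x).+1 m) => lt; last by lia.
have lt' : (s x).-1 < m by lia.
have : (s^-1)%g (Ordinal lt) = (s^-1)%g (Ordinal lt').
  by apply: h; rewrite /in_mem /= adjE permKV /=; lia.
by move/perm_inj => [] /=; lia.
Qed.

(** The endpoint found by the program may be the last item of the given order, which is then
    reversed. *)
Lemma path_order_from (x : 'I_m) : #|adj x| <= 1 ->
  exists2 s0, path_order adj s0 & s0 x = 0 :> nat.
Proof.
case/path_endpoint_pos => sx; first by exists s.
have inj : injective (fun y => rev_ord (s y)).
  by move=> y z /rev_ord_inj /perm_inj.
exists (perm inj); last by rewrite permE /= sx; have := ltn_ord x; lia.
move=> y z; rewrite adjE !permE /=; have := ltn_ord (s y); have := ltn_ord (s z); lia.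
Qed.

End Endpoints.

Definition EF_prog : com :=
  init_prog ;; endpoint_prog ;; walk_prog ;; prefix_prog ;; types_prog ;;
  target_prog ;; search_prog.

Lemma Sn_same m inp ord i j q : samen m inp i j -> (forall k, k < q -> ord k < m) ->
  Sn m inp ord i q = Sn m inp ord j q.
Proof.
move=> h hord.
have e1 v : v < m -> numn m inp i v = numn m inp j v.
  by move=> vm; have := h (v + v) (ltac:(lia)); rewrite /numn !addnA.
have e2 v : v < m -> denn m inp i v = denn m inp j v.
  by move=> vm; have := h (v + v + 1) (ltac:(lia)); rewrite /denn !addnA.
apply: eq_big_nat => k /andP[_ kq]; rewrite /wn e1 ?hord //; congr (_ * _).
by rewrite big_nat_cond [RHS]big_nat_cond; apply: eq_bigr => v /andP[/andP[_ /e2]].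
Qed.

Lemma items_gt0 m n (u : 'I_n -> 'I_m -> rat) : 0 < n -> valid_utilities u -> 0 < m.
Proof.
move=> n_gt0 [_ /(_ (Ordinal n_gt0)) h]; case: (posnP m) => // m0.
move/eqP: h; rewrite big1; first by rewrite eq_sym oner_eq0.
by move=> x; have := ltn_ord x; rewrite {2}m0.
Qed.

(** The bound on [m.+1 * m.+1] lets one digit in base [L] hold two cuts, [n < L] excludes carries,
    and [n * 2 < L] bounds the target code. *)
Lemma size_encode_bounds m n (adj : rel 'I_m) (u : 'I_n -> 'I_m -> rat) :
  0 < m -> 0 < n -> let L := size (encode adj u) in
  [/\ n < L, m.+1 * m.+1 <= L, n * 2 < L, m + m < L & 4 < L].
Proof. by move=> m_gt0 n_gt0; rewrite size_encode; split; nia. Qed.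

Section Correctness.
Variables (m n Y : nat) (adj : rel 'I_m) (u : 'I_n -> 'I_m -> rat).
Hypotheses (n_gt0 : 0 < n) (pathG : is_path_graph adj) (valU : valid_utilities u).
Notation enc := (encode adj u).
Let L := size enc.
Hypothesis Y_ge : L ^ (num_types u).+2 <= Y.
Hypothesis den_lt : forall i v, `|denq (u i v)|%N < 2 ^ Y.

Lemma EF_prog_correct s : loaded enc s ->
  wp Y EF_prog (fun s' => exists2 b : bool, s'.1 1 = b &
    (b <-> has_complete_EF adj u)) s.
Proof.
case=> l0 li.
have m_gt0 := items_gt0 n_gt0 valU.
have [nL mL n2L m2L L4] := size_encode_bounds adj u m_gt0 n_gt0.
have [u_ge0 _] := valU.
have [[_ irr] [sg adjE]] := pathG.
have LY : L < Y.
  apply: leq_trans Y_ge; rewrite -{1}(expn1 L) ltn_exp2l //; lia.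
have mY : m + m < Y by lia.
have nY : n < Y by lia.
(* The entry destroyed by the prelude is the adjacency of item 0 with itself, which is 0 in a simple
   graph. *)
pose inp := upd (s.2 0) 3 0.
have inpE j : 0 < j <= size enc -> inp j = nth 0 enc j.-1.
  move=> hj; rewrite /inp /upd; case: (altP (j =P 3)) => [->|j3]; last exact: li.
  have := nth_encode_adj adj u (Ordinal m_gt0) (Ordinal m_gt0).
  by rewrite /= mul0n !addn0 irr.
wseq; apply: (@wp_conseq _ _ (base L m n inp)); last first.
  have e1 : s.2 0 1 = m by rewrite li //; lia.
  have e2 : s.2 0 2 = n by rewrite li //; lia.
  wseq; wsto; do 3 (wseq; wasg); wseq; apply: wp_mul => //=.
    by rewrite /= /upd /= e1; apply: ltn2Y; lia.
  move=> s1 f1; rewrite /= /upd /= e1 => h5; wasg; rewrite /base /= /upd /= h5.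
  by frw f1; rewrite e1 e2 addn1.
move=> s1 b1.
have degE (x : 'I_m) : degn m inp x = #|adj x|.
  rewrite /degn big_mkord -sum1_card [RHS]big_mkcond; apply: eq_bigr => y _.
  by rewrite (adjnE inpE) /in_mem /=; case: (adj x y).
wseq; apply: wp_use (endpoint_correct mY nY LY b1 _) _.
  by have [x hx] := path_endpoint_exists adjE m_gt0; exists x; rewrite ?degE.
move=> s2 f2 [cm cd]; have b2 := base_fr f2 b1 isT.
have [s0 adjE0 s00] : exists2 s0, path_order adj s0 & s0 (Ordinal cm) = 0 :> nat.
  by apply: (path_order_from adjE); rewrite -degE.
pose p k : nat := if insub k is Some x then s0 x else 0.
have pE (x : 'I_m) : p x = s0 x by rewrite /p valK.
wseq; apply: wp_use (walk_correct (p := p) mY nY LY b2 _ _ _ _ cm _) _.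
- by move=> x xm; rewrite (pE (Ordinal xm)) ltn_ord.
- move=> x y xm ym; rewrite (pE (Ordinal xm)) (pE (Ordinal ym)) => h.
  by have /perm_inj [] := val_inj h.
- move=> k km; exists ((s0^-1)%g (Ordinal km)) => //.
  by rewrite pE permKV.
- by move=> x y xm ym; rewrite (adjnE inpE (Ordinal xm) (Ordinal ym)) adjE0 -!pE.
- by rewrite (pE (Ordinal cm)).
move=> s3 f3 hord; have b3 := base_fr f3 b2 isT.
set ord := s3.2 1 in hord.
have hord' k : k < m -> exists2 x : 'I_m, ord k = x :> nat & s0 x = k :> nat.
  move=> km; have [h1 h2] := hord k km.
  by exists (Ordinal h1) => //; rewrite -pE.
wseq; apply: wp_use (prefix_correct mY nY LY b3 _) _.
  by move=> i v ic vm; rewrite (dennE inpE (Ordinal ic) (Ordinal vm)).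
move=> s4 f4; rewrite -/ord => hS; have b4 := base_fr f4 b3 isT.
wseq; apply: wp_use (types_correct mY nY LY b4) _.
move=> s5 f5 [t [d ht]]; have b5 := base_fr f5 b4 isT.
have dp := typing_num_types inpE u_ge0 ht.
have [hpw hW hts _] := ht.
wseq; apply: wp_use (target_correct nY b5) _ => s6 f6 h20.
have b6 := base_fr f6 b5 isT.
set S := s4.2 3 in hS; set W := s5.2 2 in hW h20; set pw := s5.1 19 in hpw h20.
have L1 : 1 < L by lia.
have pwp : pw <= L ^ num_types u by rewrite hpw leq_exp2l.
have tgtE := h20; set tgt := s6.1 20 in tgtE.
have Wpw i : i < n -> W i <= pw.
  by case/hW => -> td; rewrite hpw leq_exp2l // ltnW.
have tgt_lt : tgt < L ^ (num_types u).+1.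
  have : tgt <= n * 2 * pw.
    rewrite tgtE big_mkord -mulnA -[X in X * _]card_ord -sum_nat_const.
    by apply: leq_sum => i _; have := Wpw i (ltn_ord i); lia.
  have pw_gt0 : 0 < pw by rewrite hpw expn_gt0; lia.
  move=> h; rewrite expnS; apply: leq_ltn_trans h _.
  apply: leq_trans (_ : L * pw <= _); last by rewrite leq_mul2l pwp orbT.
  by rewrite ltn_pmul2r.
have pow2 : L ^ (num_types u).+1 <= Y.
  by apply: leq_trans Y_ge; rewrite leq_exp2l.
have e6 : env m n pw W S L tgt s6.
  have [g0 g2 g3 g4 _] := b6; split=> //; split=> //.
  - by frw f6.
  - by frw f6.
  - by frw f6; frw f5.
have hS' i j : i < n -> j < n -> t i = t j -> forall q, q <= m ->
    S (i * m.+1 + q) = S (j * m.+1 + q).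
  move=> ic jc tij q qm; rewrite !hS //; apply: Sn_same; first exact/hts.
  by move=> k kq; have [] := hord k (leq_trans kq qm).
have SE (i : 'I_n) q : q <= m -> ((S (i * m.+1 + q)%N)%:R =
    (\prod_(x : 'I_m) (denn m inp i x)%:R) * \sum_(x : 'I_m | (s0 x < q)%N) u i x)%R.
  by move=> qm; rewrite hS //; apply: (Sn_sum inpE u_ge0).
have D_gt0 (i : 'I_n) : (0 < \prod_(x : 'I_m) (denn m inp i x)%:R :> rat)%R.
  by apply: prodr_gt0 => x _; rewrite ltr0n (denn_gt0 inpE).
have EFE := has_complete_EF_interval adjE0 D_gt0 u_ge0 SE.
apply: wp_conseq (search_correct _ nY LY _ _ _ _ _ e6) => //.
- move=> s7 [b eb hb]; exists b => //; rewrite hb EFE tgtE hpw; split.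
    by case=> g _; apply: (reach_interval_EF nL mL hW hS').
  exact: (interval_EF_reach nL mL hW hS').
- by lia.
- exact: leq_trans tgt_lt pow2.
- by apply: leq_trans pwp (leq_trans _ pow2); rewrite leq_exp2l.
- by rewrite hpw expn_gt0; lia.
- by move=> i /hW [-> _]; rewrite expn_gt0; lia.
Qed.

End Correctness.

Lemma wf_EF_prog : wfc EF_prog.
Proof. by []. Qed.

Lemma linear_computable K : computable (fun x => K * x.+2).
Proof.
exists ([:: IConst 0 0; IConst 2 2; IAdd 1 1 2] ++ nseq K (IAdd 0 0 1)) => x.
set P := _ ++ _.
have st : all straight P by rewrite all_cat /= all_nseq orbT.
have := @code_at_middle [::] P [::]; rewrite cats0 /= => hc.
have n1 := nsteps_straight (init_state [:: x]).2 st hc.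
exists (size P), (size P); rewrite (run_nsteps n1) add0n; split=> //.
  by rewrite /= nth_default.
rewrite /P srun_cat; set R := (X in srun (nseq _ _) X).
have R1 : R 1 = x.+2 by rewrite /R /= /upd /= addn2.
have R0 : R 0 = 0 by [].
suff h k R' : R' 1 = x.+2 -> srun (nseq k (IAdd 0 0 1)) R' 0 = R' 0 + k * x.+2.
  by rewrite /= h // R0.
elim: k R' => [|k IH] R' r1 /=; first by rewrite addn0.
by rewrite -/(srun _ _) IH ?upd_same ?upd_other // r1 mulSn addnA.
Qed.

Lemma size_le_enc_size inp : size inp <= enc_size inp.
Proof. by rewrite /enc_size -sum1_size; apply: leq_sum. Qed.

Lemma mem_enc_size inp x : x \in inp -> x < 2 ^ enc_size inp.
Proof.
move=> xi; apply: leq_trans (trunc_log_ltn x (isT : 1 < 2)) _.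
by rewrite leq_exp2l // /enc_size (big_rem x) //= leq_addr.
Qed.

Local Open Scope ring_scope.

Theorem theorem7 :
  exists f : nat -> nat, computable f /\
  exists P : program,
    forall (m n : nat) (adj : rel 'I_m) (u : 'I_n -> 'I_m -> rat),
      (0 < n)%N ->
      is_path_graph adj ->
      valid_utilities u ->
      exists b : bool,
        halts_within P (encode adj u)
          (enc_size (encode adj u) ^ f (num_types u))%N (nat_of_bool b) /\
        (b <-> has_complete_EF adj u).
Proof.
(* The program costs [Y ^ dg EF_prog], moving the input is covered by [Y ^ 4], and [Y] is the input
   size to the power [p.+2]. *)
exists (fun x => (4 + dg EF_prog) * x.+2)%N; split; first exact: linear_computable.
exists (compile EF_prog) => m n adj u n_gt0 pathG valU.
set inp := encode adj u; set E := enc_size inp; set p := num_types u.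
pose Y := (E ^ p.+2)%N.
have m_gt0 := items_gt0 n_gt0 valU.
have [_ _ _ _ L4] := size_encode_bounds adj u m_gt0 n_gt0.
have LE : (size inp <= E)%N := size_le_enc_size inp.
have E4 : (4 < E)%N by apply: leq_trans L4 LE.
have E2 : (E <= E ^ 2)%N by rewrite expnS expn1 leq_pmulr //; lia.
have EY : (E ^ 2 <= Y)%N by rewrite leq_exp2l //; lia.
(* From 25 on, [141 + 9 * Y] is at most [25 * Y], hence at most [Y ^ 2]. *)
have Y16 : (25 <= Y)%N by apply: leq_trans EY; rewrite -[25%N]/(5 ^ 2)%N leq_exp2r.
have Y_ge : (size inp ^ p.+2 <= Y)%N by rewrite leq_exp2r.
have den_lt i v : (`|denq (u i v)|%N < 2 ^ Y)%N.
  apply: leq_trans (mem_enc_size (inp := inp) _) _; last first.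
    by rewrite leq_exp2l //; apply: leq_trans E2 EY.
  rewrite /inp /encode !mem_cat; apply/orP; right; apply/orP; right.
  apply/flatten_mapP; exists i; first by rewrite mem_enum.
  apply/flatten_mapP; exists v; first by rewrite mem_enum.
  by rewrite !inE eqxx orbT.
have [s [[b eb hb] [k [hk h1 h2]]]] := compile_correct wf_EF_prog
  (EF_prog_correct n_gt0 pathG valU Y_ge den_lt).
exists b; split=> //; exists k; split=> //; last by rewrite h2.
apply: leq_trans hk _; rewrite -[X in (_ <= E ^ X)%N]mulnC expnM -/Y.
apply: leq_add_expn => //; [lia| |apply: tb_dg; lia].
apply: (@leq_trans (Y ^ 2)); last by rewrite leq_pexp2l //; lia.
have LY : (size inp <= Y)%N by apply: leq_trans LE (leq_trans E2 EY).
have : (25 * Y <= Y ^ 2)%N by rewrite expnS expn1 leq_mul2r Y16 orbT.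
rewrite -/inp; lia.
Qed.
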